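(* Let $(\mathbf{A},\mathbf{B})$ be a finite template for which the decision problem $\mathrm{PCSP}(\mathbf{A},\mathbf{B})$ has a polynomial-time solution, and suppose that $\mathrm{NP}\neq\mathrm{coNP}$. Then the search problem $\mathrm{sPCSP}(\mathbf{A},\mathbf{B})$ is not FNP-hard. In particular, if $\mathrm{sPCSP}(\mathbf{A},\mathbf{B})$ has no polynomial-time solution, then it is FNP-intermediate.
   Context: A finite template is a pair $(\mathbf{A},\mathbf{B})$ of finite relational structures of the same signature with a homomorphism $\mathbf{A}\to\mathbf{B}$. $\mathrm{PCSP}(\mathbf{A},\mathbf{B})$: given a finite structure $\mathbf{I}$, accept if $\mathbf{I}\to\mathbf{A}$ and reject if $\mathbf{I}\not\to\mathbf{B}$ (no requirement otherwise). $\mathrm{sPCSP}(\mathbf{A},\mathbf{B})$: given finite $\mathbf{I}$, output a homomorphism $\mathbf{I}\to\mathbf{B}$ if $\mathbf{I}\to\mathbf{A}$, and reject if $\mathbf{I}\not\to\mathbf{B}$. FNP-hardness is with respect to generalized many-one reductions: a pair $(\alpha,\beta)$ of polynomial-time maps such that whenever $\mathbf{z}$ is a valid answer (possibly the rejection symbol) to $\alpha(\mathbf{x})$ in the target problem, $\beta(\mathbf{x},\mathbf{z})$ is a valid answer (possibly rejection) to $\mathbf{x}$ in the source problem. FNP-intermediate means in FNP, not solvable in polynomial time, and not FNP-hard. *)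

(* Defs.v *)
From HB Require Import structures.
From Stdlib Require Import FunctionalExtensionality.
From mathcomp Require Import all_boot all_order all_algebra.

Set Implicit Arguments.
Unset Strict Implicit.
Unset Printing Implicit Defensive.

Notation bits := (seq bool).

(** * Deterministic multi-tape Turing machines

    The tape symbols are the two bits and the blank [None].  A tape is
    infinite in both directions: [(l, r)] lists the cells strictly to the left
    of the head (nearest first) and the cells from the head rightwards; cells
    beyond the lists are blank. *)

Definition tape : Type := (seq (option bool) * seq (option bool))%type.

Inductive move := Left | Stay | Right.

Definition tape_read (t : tape) : option bool := head None t.2.

Definition tape_act (a : option bool * move) (t : tape) : tape :=
  let: (l, r) := (t.1, behead t.2) in
  match a.2 with
  | Left => (behead l, [:: head None l, a.1 & r])
  | Stay => (l, a.1 :: r)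
  | Right => (a.1 :: l, r)
  end.

Record machine := Machine {
  ntapes : nat;
  state : finType;
  start : state;
  halting : pred state;
  trans : state -> {ffun 'I_ntapes.+1 -> option bool} ->
          state * {ffun 'I_ntapes.+1 -> option bool * move}
}.

Definition config (M : machine) : Type :=
  (state M * {ffun 'I_(ntapes M).+1 -> tape})%type.

Definition step (M : machine) (c : config M) : config M :=
  if halting c.1 then c else
  let: (q, a) := trans c.1 [ffun i => tape_read (c.2 i)] in
  (q, [ffun i => tape_act (a i) (c.2 i)]).

(* The i-th input is written on the i-th tape, starting under the head; all
   other tapes are blank. *)
Definition init (M : machine) (xs : seq bits) : config M :=
  (start M, [ffun i : 'I_(ntapes M).+1 => ([::], map Some (nth [::] xs i))]).

Fixpoint bits_before_blank (s : seq (option bool)) : bits :=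
  if s is Some b :: s' then b :: bits_before_blank s' else [::].

(* The output is read on tape 0, from the head to the first blank. *)
Definition output (M : machine) (c : config M) : bits :=
  bits_before_blank (c.2 ord0).2.

Definition computes_within (M : machine) (xs : seq bits) (y : bits) (t : nat) :=
  exists n, [/\ n <= t, halting (iter n (@step M) (init M xs)).1
              & output (iter n (@step M) (init M xs)) = y].

(** * Polynomial time *)

(* [polytime inp out]: one machine, on the input strings [inp x], outputs
   [out x], in time polynomial in the total input length, for every [x : X].
   Thus [X] together with [inp] is the set of legal inputs; nothing is required
   of the machine on other strings. *)
Definition polytime (X : Type) (inp : X -> seq bits) (out : X -> bits) : Prop :=
  exists (M : machine) (p : {poly nat}), forall x : X,
    computes_within M (inp x) (out x) p.[sumn (map size (inp x))]%R.

Definition enc_bool (b : bool) : bits := [:: b].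

Definition enc_option (z : option bits) : bits :=
  if z is Some y then true :: y else [:: false].

(** * NP and coNP *)

Definition language := bits -> Prop.

Definition inNP (L : language) : Prop :=
  exists (V : bits -> bits -> bool) (p : {poly nat}),
    polytime (fun xy : bits * bits => [:: xy.1; xy.2])
             (fun xy => enc_bool (V xy.1 xy.2)) /\
    forall x, L x <-> exists y, size y <= p.[size x]%R /\ V x y.

Definition incoNP (L : language) : Prop := inNP (fun x => ~ L x).

Definition NP_neq_coNP : Prop := ~ (forall L, inNP L <-> incoNP L).

(** * Search problems and FNP *)

(* On instance [x], a solution must be found if [promise x] holds, and [x] must
   be rejected if it has no solution.  An ordinary search problem is the case
   where [promise x] says that [x] has a solution. *)
Record search_problem := SearchProblem {
  instance : Type;
  enc : instance -> bits;
  enc_inj : injective enc;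
  promise : instance -> Prop;
  solution : instance -> bits -> Prop;
  promise_solvable : forall x, promise x -> exists y, solution x y
}.

(* The answer [None] is the rejection symbol. *)
Definition valid (S : search_problem) (x : instance S) (z : option bits) :=
  (promise x -> exists2 y, z = Some y & solution x y) /\
  ((forall y, ~ solution x y) -> z = None).

Definition polytime_solvable (S : search_problem) : Prop :=
  exists f : instance S -> option bits,
    polytime (fun x => [:: enc x]) (fun x => enc_option (f x)) /\
    forall x, valid x (f x).

Definition inFNP (S : search_problem) : Prop :=
  exists (V : instance S -> bits -> bool) (p : {poly nat}),
    polytime (fun xy : instance S * bits => [:: enc xy.1; xy.2])
             (fun xy => enc_bool (V xy.1 xy.2)) /\
    forall x y, solution x y <-> size y <= p.[size (enc x)]%R /\ V x y.

Definition reduces (S T : search_problem) : Prop :=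
  exists (alpha : instance S -> instance T)
         (beta : instance S -> option bits -> option bits),
    [/\ polytime (fun x => [:: enc x]) (fun x => enc (alpha x)),
        polytime (fun xz : instance S * option bits =>
                    [:: enc xz.1; enc_option xz.2])
                 (fun xz => enc_option (beta xz.1 xz.2))
      & forall x z, valid (alpha x) z -> valid x (beta x z)].

Definition FNP_hard (T : search_problem) : Prop :=
  forall S, inFNP S -> reduces S T.

Definition FNP_intermediate (S : search_problem) : Prop :=
  [/\ inFNP S, ~ polytime_solvable S & ~ FNP_hard S].

(** * Finite relational structures *)

Record signature := Signature {
  symbol : finType;
  arity : symbol -> nat
}.

Record structure (sigma : signature) := Structure {
  dom : finType;
  rel : forall s : symbol sigma, {set (arity s).-tuple dom}
}.

Definition is_hom (sigma : signature) (A B : structure sigma)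
    (h : dom A -> dom B) : Prop :=
  forall (s : symbol sigma) (t : (arity s).-tuple (dom A)),
    t \in rel A s -> map_tuple h t \in rel B s.

Definition hom_to (sigma : signature) (A B : structure sigma) : Prop :=
  exists h : dom A -> dom B, is_hom h.

Record template (sigma : signature) := Template {
  tA : structure sigma;
  tB : structure sigma;
  tAB : hom_to tA tB
}.

(* To be written as strings, input structures have domain {0, ..., n-1}. *)
Record input (sigma : signature) := Input {
  isize : nat;
  irel : forall s : symbol sigma, {set (arity s).-tuple 'I_isize}
}.

Coercion input_structure (sigma : signature) (I : input sigma) :
  structure sigma := @Structure sigma 'I_(isize I) (@irel sigma I).

(** ** Encodings *)

Definition unary (n : nat) : bits := rcons (nseq n true) false.

Definition enc_ords (n : nat) (t : seq 'I_n) : bits :=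
  flatten [seq unary i | i : 'I_n <- t].

(* A list of tuples of known common length: each is preceded by [true], and
   [false] marks the end. *)
Definition enc_tuples (n k : nat) (ts : seq (k.-tuple 'I_n)) : bits :=
  rcons (flatten [seq true :: enc_ords t | t : k.-tuple 'I_n <- ts]) false.

Definition enc_input (sigma : signature) (I : input sigma) : bits :=
  unary (isize I) ++
  flatten [seq enc_tuples (enum (irel I s)) | s <- enum (symbol sigma)].

(* The values h 0, ..., h (n-1), each given by its rank in the domain of B. *)
Definition enc_hom (sigma : signature) (I : input sigma) (B : structure sigma)
    (h : dom I -> dom B) : bits :=
  enc_ords [seq enum_rank (h i) | i <- enum (dom I)].

Lemma unary_cat_inj m n s t : unary m ++ s = unary n ++ t -> m = n /\ s = t.
Proof.
rewrite /unary; elim: m n => [|m IH] [|n] //=; first by case.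
by case=> /IH [-> ->].
Qed.

Lemma enc_ords_cat_inj n (t u : seq 'I_n) s s' : size t = size u ->
  enc_ords t ++ s = enc_ords u ++ s' -> t = u /\ s = s'.
Proof.
elim: t u => [|i t IH] [|j u] //= [szE].
rewrite /enc_ords /= -!catA => /unary_cat_inj [/val_inj -> /(IH _ szE)].
by case=> -> ->.
Qed.

Lemma enc_tuples_cat_inj n k (ts us : seq (k.-tuple 'I_n)) s s' :
  enc_tuples ts ++ s = enc_tuples us ++ s' -> ts = us /\ s = s'.
Proof.
rewrite /enc_tuples !cat_rcons.
elim: ts us => [|t ts IH] [|u us] //=; first by case.
rewrite -!catA; case=> /enc_ords_cat_inj []; first by rewrite !size_tuple.
by move=> /val_inj -> /IH [-> ->].
Qed.

Lemma enc_input_inj (sigma : signature) : injective (@enc_input sigma).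
Proof.
move=> [n r] [m r'] /unary_cat_inj /= [nm]; case: m / nm r' => r' eq_r.
suff -> : r = r' by []; apply: functional_extensionality_dep => s.
have: s \in enum (symbol sigma) by rewrite mem_enum.
elim: (enum (symbol sigma)) eq_r => [|s' ss IH] //= /enc_tuples_cat_inj.
case=> eq_s /IH {}IH; rewrite inE => /orP [/eqP ->|//].
by apply/setP => t; rewrite -mem_enum eq_s mem_enum.
Qed.

(** * PCSP and its search version *)

Definition PCSP_polytime (sigma : signature) (T : template sigma) : Prop :=
  exists f : input sigma -> bool,
    polytime (fun I => [:: enc_input I]) (fun I => enc_bool (f I)) /\
    forall I : input sigma,
      (hom_to I (tA T) -> f I = true) /\ (~ hom_to I (tB T) -> f I = false).

Definition sPCSP_solution (sigma : signature) (T : template sigma)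
    (I : input sigma) (y : bits) : Prop :=
  exists2 h : dom I -> dom (tB T), is_hom h & y = enc_hom h.

Lemma sPCSP_promise_solvable (sigma : signature) (T : template sigma)
    (I : input sigma) :
  hom_to I (tA T) -> exists y, sPCSP_solution T I y.
Proof.
case=> h hh; case: (tAB T) => g hg; exists (enc_hom (g \o h)), (g \o h) => //.
move=> s t /hh /hg; suff -> : map_tuple (g \o h) t =
  map_tuple g (map_tuple h t) by [].
by apply: val_inj; rewrite /= map_comp.
Qed.

Definition sPCSP (sigma : signature) (T : template sigma) : search_problem :=
  SearchProblem (@enc_input_inj sigma) (@sPCSP_promise_solvable sigma T).

(* Main.v *)
(** Suppose that sPCSP(A, B) is FNP-hard and let L be in NP.  Reduce the search
    for NP-witnesses of L to sPCSP(A, B) by (alpha, beta).  A certificate for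
    x \notin L is a valid answer z to alpha(x) with beta(x, z) = rejection: as
    soon as z is valid, this rejection is correct, and every x has such a z that
    can be verified in polynomial time, namely a homomorphism
    alpha(x) -> B if there is one, and otherwise the rejection symbol, whose
    validity is witnessed by the polynomial-time algorithm for PCSP(A, B)
    answering "no".  Hence NP = coNP.

    Tapes are viewed as pairs of streams, so that machines can be composed
    without keeping track of trailing blanks; apart from the tapes of a machine
    that has been run, every tape is used as a stack of bits. *)

From Stdlib Require Import FunctionalExtensionality Classical.
From mathcomp Require Import all_boot all_algebra zify.
Require Import Defs.

Set Implicit Arguments.
Unset Strict Implicit.
Unset Printing Implicit Defensive.

(** Validity leaves a gap: if [alpha x] maps to B but not to A, then a homomorphism and the
    rejection symbol are both valid, and the algorithm for PCSP may answer either way. The gap is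
    harmless. A negative answer excludes a homomorphism to A, so rejection is valid; a positive
    answer guarantees a homomorphism to B, which can be guessed. Since it is guessed and not
    computed, the outcome is NP = coNP rather than P = NP. Most of the work lies in the certificate
    checker: [polytime] asks for an actual machine, so [alpha], [beta], the PCSP algorithm and a
    homomorphism test have to be assembled into one. The homomorphism test relies on the template
    being fixed: elements and relations of B are stored in control states. *)

Definition stream := nat -> option bool.
Definition blank : stream := fun=> None.
Definition scons (a : option bool) (r : stream) : stream :=
  fun i => if i is j.+1 then r j else a.
Definition stail (r : stream) : stream := fun i => r i.+1.
Definition sprefix (s : bits) (r : stream) : stream :=
  foldr (fun b => scons (Some b)) r s.

Definition stape : Type := (stream * stream)%type.
Definition sread (t : stape) : option bool := t.2 0.
Definition sact (a : option bool * move) (t : stape) : stape :=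
  match a.2 with
  | Left => (stail t.1, scons (t.1 0) (scons a.1 (stail t.2)))
  | Stay => (t.1, scons a.1 (stail t.2))
  | Right => (scons a.1 t.1, stail t.2)
  end.

Definition tape_stream (t : tape) : stape := (nth None t.1, nth None t.2).
Definition stack (s : bits) : stape := (blank, sprefix s blank).

(* The cells beyond the first blank are unconstrained, as is the left half. *)
Definition shows (t : stape) (s : bits) : Prop :=
  exists2 r, r 0 = None & t.2 = sprefix s r.

Lemma scons_stail r : scons (r 0) (stail r) = r.
Proof. by apply: functional_extensionality => -[]. Qed.

Lemma stail_scons a r : stail (scons a r) = r.
Proof. by []. Qed.

Lemma scons_blank : scons None blank = blank.
Proof. by apply: functional_extensionality => -[]. Qed.

Lemma sact_read t : sact (sread t, Stay) t = t.
Proof. by case: t => l r; rewrite /sact /sread /= scons_stail. Qed.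

Lemma sread_stack s : sread (stack s) = ohead s.
Proof. by case: s. Qed.

Lemma shows_stack s : shows (stack s) s.
Proof. by exists blank. Qed.

Lemma tape_stream_read t : sread (tape_stream t) = tape_read t.
Proof. by rewrite /sread /tape_read /= nth0. Qed.

Lemma tape_stream_act a t :
  tape_stream (tape_act a t) = sact a (tape_stream t).
Proof.
have tailE s : nth None (behead s) = stail (nth None s).
  by apply: functional_extensionality => i; rewrite nth_behead.
have consE b s : nth None (b :: s) = scons b (nth None s).
  by apply: functional_extensionality => -[].
case: a t => a [] [l r]; rewrite /tape_act /sact /tape_stream /=;
  by rewrite ?consE ?tailE -?nth0.
Qed.

Lemma tape_stream_stack s : tape_stream ([::], map Some s) = stack s.
Proof.
congr pair; apply: functional_extensionality => i; first exact: nth_nil.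
by elim: s i => [|b s IH] [|i] //=; rewrite ?nth_nil ?IH.
Qed.

Lemma tape_stream_shows t : shows (tape_stream t) (bits_before_blank t.2).
Proof.
case: t => l r /=; elim: r => [|[b|] r [q q0 /= qE]].
- by exists blank => //=; apply: functional_extensionality => i; rewrite nth_nil.
- exists q => //=; rewrite -qE /=.
  by apply: functional_extensionality => -[].
- by exists (nth None (None :: r)).
Qed.

Lemma shows_bits_before_blank t s :
  shows (tape_stream t) s -> bits_before_blank t.2 = s.
Proof.
case: t => l r [q q0 /=].
elim: s r => [|b s IH] [|[c|] r] //= E; have := congr1 (fun f => f 0) E => //=.
- by rewrite q0.
- case=> ->; rewrite (IH r) //; have := congr1 stail E.
  by rewrite /= stail_scons => <-; apply: functional_extensionality.
Qed.

(** * Program fragments *)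

(* A transition to [None] leaves the fragment. *)
Record frag (V : finType) := Frag {
  fstate : finType;
  fstart : fstate;
  ftrans : fstate -> (V -> option bool) ->
           option fstate * (V -> option bool * move)
}.

Definition reads (V : finType) (t : V -> stape) : V -> option bool :=
  fun v => sread (t v).
Definition acts (V : finType) (a : V -> option bool * move) (t : V -> stape) :
  V -> stape := fun v => sact (a v) (t v).
Definition idle (V : finType) (r : V -> option bool) : V -> option bool * move :=
  fun v => (r v, Stay).

Lemma acts_idle (V : finType) (t : V -> stape) : acts (idle (reads t)) t = t.
Proof. by apply: functional_extensionality => v; apply: sact_read. Qed.

Inductive run (V : finType) (F : frag V) :
    fstate F -> (V -> stape) -> nat -> (V -> stape) -> Prop :=
| run_exit q t a : ftrans q (reads t) = (None, a) -> run q t 1 (acts a t)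
| run_step q t a q' n t' : ftrans q (reads t) = (Some q', a) ->
    run q' (acts a t) n t' -> run q t n.+1 t'.

(** The count is an upper bound, so that running times can be given in closed form and weakened at
    will. *)
Definition exec (V : finType) (F : frag V) (t : V -> stape) (n : nat)
    (t' : V -> stape) : Prop :=
  exists2 m, m <= n & run (fstart F) t m t'.

Lemma exec_leq (V : finType) (F : frag V) t t' n m :
  n <= m -> exec F t n t' -> exec F t m t'.
Proof. by move=> le_nm [k le_kn r]; exists k => //; apply: leq_trans le_nm. Qed.

Definition fseq (V : finType) (F G : frag V) : frag V :=
  @Frag V (fstate F + fstate G)%type (inl (fstart F)) (fun q r =>
    match q with
    | inl q => let: (o, a) := ftrans q r in
               (Some (if o is Some q' then inl q' else inr (fstart G)), a)
    | inr q => let: (o, a) := ftrans q r in (omap inr o, a)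
    end).

(** The last action of [F] is performed in the very transition that enters [G]; hence the times add
    without overhead. *)
Lemma exec_seq (V : finType) (F G : frag V) t u w n m :
  exec F t n u -> exec G u m w -> exec (fseq F G) t (n + m) w.
Proof.
case=> n' le_n rF [m' le_m rG]; exists (n' + m'); first exact: leq_add.
have {}rG : run (inr (fstart G) : fstate (fseq F G)) u m' w.
  elim: rG => [q x a E|q x a q' k x' E _ IH].
    by apply: run_exit; rewrite /= E.
  by apply: run_step IH; rewrite /= E.
rewrite /=; elim: rF rG => [q x a E|q x a q' k x' E _ IH] rG.
  by apply: run_step rG; rewrite /= E.
by apply: run_step (IH rG); rewrite /= E.
Qed.

Definition fif (V : finType) (b : (V -> option bool) -> bool) (F G : frag V) :
    frag V :=
  @Frag V (option (fstate F + fstate G)) None (fun q r =>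
    match q with
    | None => (Some (Some (if b r then inl (fstart F) else inr (fstart G))),
               idle r)
    | Some (inl q) => let: (o, a) := ftrans q r in
                      (omap (fun q => Some (inl q)) o, a)
    | Some (inr q) => let: (o, a) := ftrans q r in
                      (omap (fun q => Some (inr q)) o, a)
    end).

Lemma exec_if (V : finType) (b : (V -> option bool) -> bool) (F G : frag V)
    t n u :
  exec (if b (reads t) then F else G) t n u -> exec (fif b F G) t n.+1 u.
Proof.
case=> n' le_n; case E: (b (reads t)) => r; exists n'.+1 => //.
- apply: (@run_step V (fif b F G) None t (idle (reads t))
                    (Some (inl (fstart F)))); first by rewrite /= E.
  rewrite acts_idle {E le_n}; elim: r => [q x a E|q x a q' k x' E _ IH].
    by apply: run_exit; rewrite /= E.
  by apply: run_step IH; rewrite /= E.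
- apply: (@run_step V (fif b F G) None t (idle (reads t))
                    (Some (inr (fstart G)))); first by rewrite /= E.
  rewrite acts_idle {E le_n}; elim: r => [q x a E|q x a q' k x' E _ IH].
    by apply: run_exit; rewrite /= E.
  by apply: run_step IH; rewrite /= E.
Qed.

Definition fwhile (V : finType) (b : (V -> option bool) -> bool) (F : frag V) :
    frag V :=
  @Frag V (option (fstate F)) None (fun q r =>
    match q with
    | None => (if b r then Some (Some (fstart F)) else None, idle r)
    (* When the body exits, [o] is [None], which is the test state of the loop. *)
    | Some q => let: (o, a) := ftrans q r in (Some o, a)
    end).

Lemma exec_while_done (V : finType) (b : (V -> option bool) -> bool)
    (F : frag V) t : b (reads t) = false -> exec (fwhile b F) t 1 t.
Proof.
move=> E; exists 1 => //; rewrite -{2}(acts_idle t).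
by apply: run_exit; rewrite /= E.
Qed.

Lemma exec_while_more (V : finType) (b : (V -> option bool) -> bool)
    (F : frag V) t n u m w :
  b (reads t) -> exec F t n u -> exec (fwhile b F) u m w ->
  exec (fwhile b F) t (n + m).+1 w.
Proof.
move=> E [n' le_n rF] [m' le_m rW]; exists (n' + m').+1.
  by rewrite ltnS leq_add.
apply: (@run_step V (fwhile b F) None t (idle (reads t)) (Some (fstart F))).
  by rewrite /= E.
rewrite acts_idle {E le_n}; elim: rF rW => [q x a E|q x a q' k x' E _ IH] rW.
  by apply: run_step rW; rewrite /= E.
by apply: run_step (IH rW); rewrite /= E.
Qed.

(** * Tapes used as stacks *)

Inductive op := Keep | Pop | Push of bool.

Definition sop (o : op) (t : stape) : stape :=
  match o with
  | Keep => t
  | Pop => (scons None t.1, stail t.2)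
  | Push b => (stail t.1, scons (Some b) t.2)
  end.

Definition bop (o : op) (s : bits) : bits :=
  match o with Keep => s | Pop => behead s | Push b => b :: s end.

(** A pop erases the cell that it leaves, so the left half stays blank; popping an empty stack only
    shifts a blank tape. *)
Lemma sop_stack o s : sop o (stack s) = stack (bop o s).
Proof.
by case: o s => [||b] [|c s] //=; rewrite /stack /= ?scons_blank.
Qed.

(* A push moves left in the first step and writes in the second. *)
Definition fops (V : finType) (o : V -> op) : frag V :=
  @Frag V bool false (fun q r =>
    if q then (None, fun v => if o v is Push b then (Some b, Stay)
                              else (r v, Stay))
    else (Some true, fun v => match o v with
                              | Keep => (r v, Stay)
                              | Pop => (None, Right)
                              | Push _ => (r v, Left)
                              end)).

Lemma exec_ops (V : finType) (o : V -> op) t :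
  exec (fops o) t 2 (fun v => sop (o v) (t v)).
Proof.
exists 2 => //; apply: (@run_step V (fops o) _ _ _ true) => [//|].
set u := acts _ t.
have -> : (fun v => sop (o v) (t v)) =
    acts (fun v => if o v is Push b then (Some b, Stay)
                   else (reads u v, Stay)) u.
  apply: functional_extensionality => v; rewrite /u /acts /reads.
  case: (o v) => [||b]; rewrite ?sact_read //=.
    by rewrite /sact /= !stail_scons /sread scons_stail.
exact: run_exit.
Qed.

Definition fskip (V : finType) : frag V := fops (fun=> Keep).

Lemma exec_skip (V : finType) (t : V -> stape) : exec (fskip V) t 2 t.
Proof. exact: exec_ops. Qed.

Definition sexec (V : finType) (F : frag V) (s : V -> bits) (n : nat)
    (s' : V -> bits) : Prop :=
  exec F (fun v => stack (s v)) n (fun v => stack (s' v)).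

Lemma reads_stack (V : finType) (s : V -> bits) :
  reads (fun v => stack (s v)) = fun v => ohead (s v).
Proof. by apply: functional_extensionality => v; apply: sread_stack. Qed.

Lemma sexec_ops (V : finType) (o : V -> op) s :
  sexec (fops o) s 2 (fun v => bop (o v) (s v)).
Proof.
rewrite /sexec (_ : (fun v => stack (bop (o v) (s v))) =
  fun v => sop (o v) (stack (s v))); first exact: exec_ops.
by apply: functional_extensionality => v; rewrite sop_stack.
Qed.

Lemma sexec_if (V : finType) (b : (V -> option bool) -> bool) (F G : frag V)
    s n u :
  sexec (if b (fun v => ohead (s v)) then F else G) s n u ->
  sexec (fif b F G) s n.+1 u.
Proof. by move=> H; apply: exec_if; rewrite reads_stack. Qed.

Lemma sexec_while_done (V : finType) (b : (V -> option bool) -> bool)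
    (F : frag V) s :
  b (fun v => ohead (s v)) = false -> sexec (fwhile b F) s 1 s.
Proof. by move=> H; apply: exec_while_done; rewrite reads_stack. Qed.

Lemma sexec_while_more (V : finType) (b : (V -> option bool) -> bool)
    (F : frag V) s n u m w :
  b (fun v => ohead (s v)) -> sexec F s n u -> sexec (fwhile b F) u m w ->
  sexec (fwhile b F) s (n + m).+1 w.
Proof. by move=> H; apply: exec_while_more; rewrite reads_stack. Qed.

(* [u] is popped up to its first blank; its bits are pushed on the tapes in
   [P], hence in reverse order. *)
Definition fmove (V : finType) (u : V) (P : pred V) : frag V :=
  let body b := fops (fun v => if v == u then Pop else
                               if P v then Push b else Keep) in
  fwhile (fun r => r u != None)
         (fif (fun r => r u == Some true) (body true) (body false)).

(** The source need only show [s], so that the output of a machine can be fetched from a tape with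
    unknown contents elsewhere. Each bit costs four steps: the loop test, the branch and two steps
    of [fops]. *)
Lemma exec_move (V : finType) (u : V) (P : pred V) (t : V -> stape) s
    (q : V -> bits) : shows (t u) s ->
  (forall v, v != u -> P v -> t v = stack (q v)) ->
  exists t' : V -> stape, [/\ exec (fmove u P) t (4 * size s + 1) t',
    forall v, v != u -> t' v = if P v then stack (catrev s (q v)) else t v
  & t u = stack s -> t' u = stack [::]].
Proof.
case=> r r0; elim: s t q => [|b s IH] t q /= tuE tP.
  exists t; split=> [|v vu|//]; last by case: ifP => // /(tP _ vu).
  by apply: exec_while_done; rewrite /reads /sread tuE r0.
pose o b := fun v => if v == u then Pop else if P v then Push b else Keep.
pose t1 := fun v => sop (o b v) (t v).
have [||t' [ex t'E t'u]] := IH t1 (fun v => b :: q v).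
- by rewrite /t1 /o eqxx /= tuE stail_scons.
- by move=> v vu Pv; rewrite /t1 /o (negbTE vu) Pv tP // sop_stack.
exists t'; split=> [|v vu|tu].
- have -> : 4 * (size s).+1 + 1 = (3 + (4 * size s + 1)).+1 by lia.
  apply: exec_while_more ex; first by rewrite /reads /sread tuE.
  apply: exec_if; rewrite /reads /sread tuE /=.
  by rewrite /t1; case: (b) => /=; apply: exec_ops.
- by rewrite t'E // /t1 /o (negbTE vu); case: (P v).
- by rewrite t'u // /t1 /o eqxx tu sop_stack.
Qed.

Definition fclear (V : finType) (u : V) : frag V := fmove u pred0.

Lemma exec_clear (V : finType) (u : V) (t : V -> stape) s : t u = stack s ->
  exec (fclear u) t (4 * size s + 1)
       (fun v => if v == u then stack [::] else t v).
Proof.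
move=> tu; have [||t' [ex t'E t'u]] := @exec_move V u pred0 t s (fun=> [::]).
- by rewrite tu; apply: shows_stack.
- by [].
rewrite (_ : (fun v => _) = t') //; apply: functional_extensionality => v.
by case: eqVneq => [->|/t'E ->//]; rewrite t'u.
Qed.

(** * Polynomial bounds with natural coefficients *)

Lemma horner_nat_leq (p : {poly nat}) m n : m <= n -> p.[m]%R <= p.[n]%R.
Proof.
move=> le_mn; elim/poly_ind: p => [|p c IH]; first by rewrite !horner0.
by rewrite !hornerMXaddC leq_add2r leq_mul.
Qed.

Lemma hornerD_nat (p q : {poly nat}) n : (p + q)%R.[n]%R = p.[n]%R + q.[n]%R.
Proof. exact: hornerD. Qed.

Lemma hornerM_nat (p q : {poly nat}) n : (p * q)%R.[n]%R = p.[n]%R * q.[n]%R.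
Proof. exact: hornerM. Qed.

Definition poly_bounded (f : nat -> nat) : Prop :=
  exists p : {poly nat}, forall n, f n <= p.[n]%R.

Lemma poly_bounded_const c : poly_bounded (fun=> c).
Proof. by exists (c%:P)%R => n; rewrite hornerC. Qed.

Lemma poly_bounded_id : poly_bounded id.
Proof. by exists 'X%R => n; rewrite hornerX. Qed.

Lemma poly_bounded_horner (p : {poly nat}) : poly_bounded (fun n => p.[n]%R).
Proof. by exists p. Qed.

Lemma poly_bounded_add f g : poly_bounded f -> poly_bounded g ->
  poly_bounded (fun n => f n + g n).
Proof.
by case=> p Hp [q Hq]; exists (p + q)%R => n; rewrite hornerD_nat leq_add.
Qed.

Lemma poly_bounded_mul f g : poly_bounded f -> poly_bounded g ->
  poly_bounded (fun n => f n * g n).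
Proof.
by case=> p Hp [q Hq]; exists (p * q)%R => n; rewrite hornerM_nat leq_mul.
Qed.

Lemma poly_bounded_horner_comp (p : {poly nat}) g : poly_bounded g ->
  poly_bounded (fun n => p.[g n]%R).
Proof.
case=> q Hq; exists (p \Po q)%R => n.
by rewrite horner_comp; apply: horner_nat_leq.
Qed.

Ltac poly_bound :=
  repeat first [ exact: poly_bounded_const | exact: poly_bounded_id
    | exact: poly_bounded_horner | apply: poly_bounded_horner_comp
    | apply: poly_bounded_add | apply: poly_bounded_mul ].

(** * Fragments as machines *)

Definition frag_machine (V : finType) (v0 : V) (vs : seq V) (F : frag V) :
    machine :=
  @Machine (size vs).-1 (option (fstate F)) (Some (fstart F)) (pred1 None)
    (fun q r => if q is Some q then
       let: (o, a) := ftrans q (fun v => r (inord (index v vs))) in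
       (o, [ffun i : 'I__ => a (nth v0 vs i)])
     else (None, [ffun=> (None, Stay)])).

Definition frag_tapes (V : finType) (v0 : V) (vs : seq V) (F : frag V)
    (c : config (frag_machine v0 vs F)) : V -> stape :=
  fun v => tape_stream (c.2 (inord (index v vs))).

Lemma frag_machine_run (V : finType) (v0 : V) (vs : seq V) (F : frag V) :
  (forall v, v \in vs) ->
  forall q t n t', run q t n t' ->
  forall c : config (frag_machine v0 vs F), c.1 = Some q -> frag_tapes c = t ->
  (iter n (@step _) c).1 = None /\ frag_tapes (iter n (@step _) c) = t'.
Proof.
move=> vsP.
have stepE (c : config (frag_machine v0 vs F)) q t o a : c.1 = Some q ->
    frag_tapes c = t -> ftrans q (reads t) = (o, a) ->
    (step c).1 = o /\ frag_tapes (step c) = acts a t.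
  case: c => q' c /= -> <- E.
  have rE : (fun v => [ffun i => tape_read (c i)] (inord (index v vs))) =
      reads (@frag_tapes V v0 vs F (Some q, c)).
    apply: functional_extensionality => v.
    by rewrite ffunE /reads /frag_tapes tape_stream_read.
  rewrite /step /= rE E /=; split=> //.
  apply: functional_extensionality => v; rewrite /frag_tapes /= !ffunE.
  rewrite tape_stream_act /acts; congr (sact (a _) _).
  have vlt : index v vs < size vs by rewrite index_mem.
  by rewrite inordK ?nth_index // prednK ?(leq_ltn_trans (leq0n _) vlt).
move=> q t n t'; elim=> [{}q {}t a E|{}q {}t a q' k {}t' E _ IH] c cq ct.
  exact: stepE E.
rewrite iterSr; have [] := stepE _ _ _ _ _ cq ct E; exact: IH.
Qed.

Lemma frag_polytime (X : Type) (inp : X -> seq bits) (out : X -> bits)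
    (V : finType) (F : frag V) (u0 : V) (us : seq V) (f : nat -> nat) :
  uniq (u0 :: us) -> (forall x, size (inp x) = (size us).+1) ->
  poly_bounded f ->
  (forall x, exists2 t',
     exec F (fun v => stack (nth [::] (inp x) (index v (u0 :: us))))
          (f (sumn (map size (inp x)))) t' & shows (t' u0) (out x)) ->
  polytime inp out.
Proof.
move=> us_uniq sz [p Hp] exF.
(* The tapes [u0 :: us] come first, so that they receive the inputs in order and [u0] becomes the
   output tape 0; the remaining tapes of the fragment start blank. *)
have [vs vsE] : exists vs,
  vs = (u0 :: us) ++ [seq v <- enum V | v \notin u0 :: us] by eexists.
have vsP v : v \in vs.
  by rewrite vsE mem_cat mem_filter mem_enum andbT orbN.
exists (frag_machine u0 vs F), p => x; have [t' [n le_n r] t'u] := exF x.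
exists n; have [||h1 h2] := @frag_machine_run V u0 vs F vsP _ _ _ _ r
    (init _ (inp x)) _ _.
- by [].
- apply: functional_extensionality => v; rewrite /frag_tapes /= !ffunE.
  rewrite tape_stream_stack; congr stack.
  have vlt : index v vs < size vs by rewrite index_mem.
  rewrite inordK ?(ltn_predK vlt) // vsE index_cat.
  case: (boolP (v \in u0 :: us)) => // vN.
  have le_sz : size (inp x) <= index v (u0 :: us).
    by rewrite sz -[(size us).+1]/(size (u0 :: us)) leqNgt index_mem.
  by rewrite !nth_default // sz leq_addr.
split; first exact: leq_trans (Hp _).
- by rewrite h1.
- apply: shows_bits_before_blank; move: t'u; rewrite -h2 /frag_tapes.
  suff -> : inord (index u0 vs) = ord0 :> 'I_(size vs).-1.+1 by [].
  by apply: ord_inj; rewrite /= inordK vsE /= eqxx.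
Qed.

(** * Machines as fragments *)

Definition fcall (V : finType) (M : machine) (e : 'I_(ntapes M).+1 -> V)
    (d : V -> option 'I_(ntapes M).+1) : frag V :=
  @Frag V (state M) (start M) (fun q r =>
    if halting q then (None, idle r) else
    let: (q', a) := trans q [ffun i => r (e i)] in
    (Some q', fun v => if d v is Some i then a i else (r v, Stay))).

(** The fragment simulates [M] step by step on the tapes in the image of [e], with [d] as partial
    inverse; the additional step is the exit from a halting state. *)
Lemma exec_call (V : finType) (M : machine) (e : 'I_(ntapes M).+1 -> V)
    (d : V -> option 'I_(ntapes M).+1) (t : V -> stape) xs n :
  pcancel e d ->
  (forall v i, d v = Some i -> t v = stack (nth [::] xs i)) ->
  halting (iter n (@step M) (init M xs)).1 ->
  exec (fcall e d) t n.+1 (fun v =>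
    if d v is Some i then tape_stream ((iter n (@step M) (init M xs)).2 i)
    else t v).
Proof.
move=> eK tE.
have {tE} : forall v i, d v = Some i -> t v = tape_stream ((init M xs).2 i).
  by move=> v i /tE ->; rewrite [(init M xs).2 i]ffunE tape_stream_stack.
rewrite /exec -[fstart _]/((init M xs).1).
elim: n (init M xs) t => [|n IH] c t tE.
  move=> h; exists 1 => //; rewrite (_ : (fun v => _) = t).
    rewrite -{2}(acts_idle t); apply: run_exit; rewrite /= h //.
  apply: functional_extensionality => v.
  by case dv: (d v) => [i|] //; rewrite (tE _ _ dv).
(* The machine may have halted before [n] steps; its configuration is fixed from then on. *)
case hc: (halting c.1).
  have fixc m : iter m (@step M) c = c.
    by elim: m => // m IHm; rewrite iterSr /step hc.
  rewrite fixc => h.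
  have [|m le_m r] := IH c t tE; first by rewrite fixc.
  by exists m; [apply: leqW | move: r; rewrite fixc].
rewrite iterSr => h.
case E: (trans c.1 [ffun i => tape_read (c.2 i)]) => [q' a].
pose a' := fun v => if d v is Some i then a i else (reads t v, Stay).
have scE : step c = (q', [ffun i => tape_act (a i) (c.2 i)]).
  by rewrite /step hc E.
have [|//|m le_m r] := IH (step c) (acts a' t).
  move=> v i dv; rewrite scE /= ffunE tape_stream_act -(tE _ _ dv).
  by rewrite /acts /a' dv.
exists m.+1; first by [].
apply: (@run_step V (fcall e d) _ _ a' q').
  rewrite /= hc; suff -> : [ffun i => reads t (e i)] =
    [ffun i => tape_read (c.2 i)] by rewrite E.
  by apply/ffunP => i; rewrite !ffunE /reads (tE _ _ (eK i)) tape_stream_read.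
move: r; rewrite scE /=; set g := fun v => _; set g' := fun v => _.
suff -> : g = g' by [].
apply: functional_extensionality => v; rewrite /g /g' /acts /a'.
by case: (d v) => //; rewrite sact_read.
Qed.

(** A step lengthens the right half of tape 0 by at most two cells, the extreme case being a left
    move from an empty list, where both the written and the newly scanned cell are added. *)
Lemma computes_within_size (M : machine) xs y n :
  computes_within M xs y n -> size y <= sumn (map size xs) + n.*2.
Proof.
case=> m [le_m _ <-]; rewrite /output.
have bbb s : size (bits_before_blank s) <= size s.
  by elim: s => [|[b|] s IH].
apply: leq_trans (bbb _) _.
have step_size (c : config M) :
    size ((step c).2 ord0).2 <= size (c.2 ord0).2 + 2.
  rewrite /step; case: ifP => _; first exact: leq_addr.
  case: (trans _ _) => q a /=; rewrite ffunE; case: (a ord0) => b [];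
    rewrite /tape_act /= size_behead; lia.
have szE : size (((iter m (@step M) (init M xs)).2 ord0).2)
    <= size (((init M xs).2 ord0).2) + m.*2.
  elim: m {le_m} => [|m IH]; first by rewrite addn0.
  by rewrite iterS; apply: leq_trans (step_size _) _; lia.
apply: leq_trans szE _; apply: leq_add; last by rewrite leq_double.
rewrite /= ffunE size_map; case: xs => [|x xs] //=; exact: leq_addr.
Qed.

Lemma polytime_size (X : Type) (inp : X -> seq bits) out :
  polytime inp out ->
  exists p : {poly nat}, forall x,
    size (out x) <= p.[sumn (map size (inp x))]%R.
Proof.
case=> M [p Hp]; have [||q Hq] :=
    @poly_bounded_add id (fun n => p.[n]%R + p.[n]%R); try by poly_bound.
exists q => x; apply: leq_trans (Hq _); rewrite addnn.
exact: computes_within_size.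
Qed.

(** Only the set of legal inputs is reindexed and the machine stays the same, so [h] may be any
    function, computable or not. *)
Lemma polytime_pull (X Y : Type) (h : Y -> X) (inp : X -> seq bits) out :
  polytime inp out -> polytime (fun y => inp (h y)) (fun y => out (h y)).
Proof. by case=> M [p Hp]; exists M, p => y; apply: Hp. Qed.

(** * Copying *)

(** The two moves reverse twice, and the source is a target of the second one, so it is restored. *)
Definition fcopy (V : finType) (tmp u w : V) : frag V :=
  fseq (fmove u (pred1 tmp)) (fmove tmp (pred2 u w)).

Lemma exec_copy (V : finType) (tmp u w : V) (t : V -> stape) s :
  uniq [:: tmp; u; w] ->
  t u = stack s -> t w = stack [::] -> t tmp = stack [::] ->
  exec (fcopy tmp u w) t (8 * size s + 2)
       (fun v => if v == w then stack s else t v).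
Proof.
rewrite /= !inE negb_or => /and3P [/andP [tu tw] uw _] tuE twE ttE.
have [||t1 [ex1 t1E t1u]] := @exec_move V u (pred1 tmp) t s (fun=> [::]).
- by rewrite tuE; apply: shows_stack.
- by move=> v _ /eqP ->.
have t1t : t1 tmp = stack (rev s) by rewrite t1E //= eqxx.
have [||t2 [ex2 t2E t2t]] :=
    @exec_move V tmp (pred2 u w) t1 (rev s) (fun=> [::]).
- by rewrite t1t; apply: shows_stack.
- move=> v _ /orP [/eqP ->|/eqP ->]; first exact: t1u.
  by rewrite t1E 1?eq_sym //= eq_sym (negbTE tw).
rewrite (_ : (fun v => _) = t2).
  apply: exec_leq (exec_seq ex1 ex2); rewrite size_rev; lia.
apply: functional_extensionality => v.
have catrevE : catrev (rev s) [::] = s by rewrite -/(rev _) revK.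
case: (eqVneq v tmp) => [->|vt]; first by rewrite (negbTE tw) t2t.
rewrite t2E //= catrevE orbC; case: eqP => //= _.
case: (eqVneq v u) => [->//|vu]; by rewrite t1E //= (negbTE vt).
Qed.

Fixpoint fcopies (V : finType) (tmp : V) (ps : seq (V * V)) : frag V :=
  if ps is p :: ps then fseq (fcopy tmp p.1 p.2) (fcopies tmp ps)
  else fskip V.

(** A source may be listed several times; as no source is a destination, every copy sees the
    original contents. *)
Lemma exec_copies (V : finType) (tmp : V) (ps : seq (V * V)) (t : V -> stape) N :
  (forall p, p \in ps -> exists2 s, size s <= N & t p.1 = stack s) ->
  (forall p, p \in ps -> t p.2 = stack [::]) ->
  t tmp = stack [::] -> tmp \notin unzip1 ps -> tmp \notin unzip2 ps ->
  uniq (unzip2 ps) -> ~~ has [in unzip2 ps] (unzip1 ps) ->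
  exists t' : V -> stape,
  [/\ exec (fcopies tmp ps) t (size ps * (8 * N + 2) + 2) t',
      forall v, v \notin unzip2 ps -> t' v = t v
    & forall p, p \in ps -> t' p.2 = t p.1].
Proof.
elim: ps t => [|[u w] ps IH] t src dst tE /=.
  by exists t; split=> //; apply: exec_skip.
rewrite !inE !negb_or => /andP [tu tps1] /andP [tw tps2] /andP [wps ups].
case/andP=> /andP [uw uNps] /hasPn disj.
have [s sz tuE] := src (u, w) (mem_head _ _).
have twE : t w = stack [::] := dst (u, w) (mem_head _ _).
have ex1 : exec (fcopy tmp u w) t (8 * N + 2)
    (fun v => if v == w then stack s else t v).
  apply: (@exec_leq _ _ _ _ (8 * size s + 2)); first by lia.
  apply: exec_copy => //=; rewrite !inE negb_or tu tw /= andbT; exact: uw.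
have srcNw p : p \in ps -> p.1 != w.
  move=> pps; have /disj : p.1 \in unzip1 ps by apply: map_f.
  by rewrite !inE negb_or => /andP [].
have dstNw p : p \in ps -> p.2 != w.
  by move=> pps; apply: contra wps => /eqP <-; apply: map_f.
have [|||||||t' [ex2 t'1 t'2]] := IH (fun v => if v == w then stack s else t v).
- move=> p pps; rewrite (negbTE (srcNw _ pps)); apply: src.
  by rewrite inE pps orbT.
- move=> p pps; rewrite (negbTE (dstNw _ pps)); apply: dst.
  by rewrite inE pps orbT.
- by rewrite (negbTE tw).
- by [].
- by [].
- by [].
- apply/hasPn => v /disj; by rewrite !inE negb_or => /andP [].
exists t'; split.
- by apply: exec_leq (exec_seq ex1 ex2); lia.
- move=> v; rewrite inE negb_or => /andP [vw /t'1 ->].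
  by rewrite (negbTE vw).
- move=> p; rewrite inE => /orP [/eqP ->|pps] /=.
    by rewrite t'1 // eqxx tuE.
  by rewrite t'2 // (negbTE (srcNw _ pps)).
Qed.

Definition copy_pairs (V : finType) m n (a : 'I_m -> V) (f : 'I_n -> V)
    (src : 'I_n -> option 'I_m) : seq (V * V) :=
  pmap (fun j => omap (fun i => (a i, f j)) (src j)) (enum 'I_n).

Lemma exec_copy_pairs (V : finType) m n (a : 'I_m -> V) (f : 'I_n -> V)
    (src : 'I_n -> option 'I_m) (tmp : V) (t : V -> stape) (s : 'I_m -> bits) N :
  injective f -> (forall i j, a i != f j) -> (forall i, tmp != a i) ->
  (forall j, tmp != f j) ->
  (forall i, t (a i) = stack (s i)) -> (forall i, size (s i) <= N) ->
  (forall j, src j -> t (f j) = stack [::]) -> t tmp = stack [::] ->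
  exists t' : V -> stape,
  [/\ exec (fcopies tmp (copy_pairs a f src)) t (n * (8 * N + 2) + 2) t',
      forall v, (forall j, v != f j) -> t' v = t v
    & forall j, t' (f j) = if src j is Some i then stack (s i) else t (f j)].
Proof.
move=> f_inj af ta tf tE sz t0 tt; set ps := copy_pairs a f src.
have psP p : reflect (exists2 ij, src ij.2 = Some ij.1 & p = (a ij.1, f ij.2))
    (p \in ps).
  rewrite mem_pmap; apply: (iffP mapP) => [[j _]|[[i j] /= ji ->]].
    by case E: (src j) => [i|//] [->]; exists (i, j).
  by exists j; rewrite ?mem_enum // ji.
have [||||||| t' [ex t'1 t'2]] := @exec_copies V tmp ps t N.
- by move=> p /psP [[i j] /= _ ->] /=; exists (s i).
- by move=> p /psP [[i j] /= ji ->] /=; rewrite t0 ?ji.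
- by [].
- by apply/mapP => -[p /psP [[i j] _ ->] /= E]; move: (ta i); rewrite E eqxx.
- by apply/mapP => -[p /psP [[i j] _ ->] /= E]; move: (tf j); rewrite E eqxx.
- rewrite /ps /copy_pairs; elim: (enum 'I_n) (enum_uniq 'I_n) => //= j js IH.
  case/andP=> jjs /IH {}IH; case: (src j) => //= i; rewrite IH andbT.
  apply: contra jjs => /mapP [p]; rewrite mem_pmap => /mapP [j' j'js].
  by case: (src j') => //= i' [->] /= /f_inj ->.
- apply/hasPn => v /mapP [p /psP [[i j] _ ->] ->] /=.
  by apply/mapP => -[q /psP [[i' j'] _ ->] /= E]; move: (af i j'); rewrite E eqxx.
exists t'; split.
- apply: exec_leq ex; rewrite leq_add2r leq_mul2r; apply/orP; right.
  by rewrite size_pmap -[X in _ <= X](size_enum_ord n) count_size.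
- move=> v vf; apply: t'1; apply/mapP => -[p /psP [[i j] _ ->] /= E].
  by move: (vf j); rewrite E eqxx.
- move=> j; case E: (src j) => [i|].
    by rewrite -tE (t'2 (a i, f j)) //; apply/psP; exists (i, j).
  apply: t'1; apply/mapP => -[p /psP [[i j'] /= E' ->] /= /f_inj jj].
  by rewrite jj E' in E.
Qed.

Definition select (e : seq nat) (xs : seq bits) : seq bits :=
  [seq nth [::] xs i | i <- e].

Lemma size_nth_sumn (xs : seq bits) i :
  size (nth [::] xs i) <= sumn (map size xs).
Proof.
elim: xs i => [|x xs IH] [|i] //=; first exact: leq_addr.
by apply: leq_trans (IH i) _; apply: leq_addl.
Qed.

Lemma sumn_select e xs :
  sumn (map size (select e xs)) <= size e * sumn (map size xs).
Proof.
elim: e => [|i e IH] //=; rewrite mulSn leq_add //; exact: size_nth_sumn.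
Qed.

(** This is the composition principle: an intermediate value, computed from the inputs selected by
    [e], becomes an additional input. The two machines work on disjoint tapes, so what the first one
    leaves behind cannot disturb the second, and each result travels through [tmp] to undo the
    reversal. *)
Lemma polytime_let (X : Type) (inp : X -> seq bits) (g out : X -> bits)
    (k : nat) (e : seq nat) :
  (forall x, size (inp x) = k.+1) ->
  polytime (fun x => select e (inp x)) g ->
  polytime (fun x => g x :: inp x) out -> polytime inp out.
Proof.
move=> sz [M1 [p1 H1]] [M2 [p2 H2]].
pose V : finType :=
  (('I_k.+1 + 'I_(ntapes M1).+1) + ('I_(ntapes M2).+1 + unit))%type.
pose a (i : 'I_k.+1) : V := inl (inl i).
pose f1 (i : 'I_(ntapes M1).+1) : V := inl (inr i).
pose f2 (i : 'I_(ntapes M2).+1) : V := inr (inl i).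
pose tmp : V := inr (inr tt).
pose d1 (v : V) := if v is inl (inr i) then Some i else None.
pose d2 (v : V) := if v is inr (inl i) then Some i else None.
(* The default [k.+1] is out of range, so tapes of [M1] beyond the length of [e] receive nothing. *)
pose src1 (j : 'I_(ntapes M1).+1) : option 'I_k.+1 := insub (nth k.+1 e j).
(* Tape 0 of [M2] is reserved for [g x], hence the shift by one. *)
pose src2 (j : 'I_(ntapes M2).+1) : option 'I_k.+1 :=
  if val j is j'.+1 then insub j' else None.
pose F := fseq (fcopies tmp (copy_pairs a f1 src1))
  (fseq (fcall f1 d1) (fseq (fmove (f1 ord0) (pred1 tmp))
  (fseq (fmove tmp (pred1 (f2 ord0)))
  (fseq (fcopies tmp (copy_pairs a f2 src2)) (fseq (fclear (a ord0))
  (fseq (fcall f2 d2) (fseq (fmove (f2 ord0) (pred1 tmp))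
        (fmove tmp (pred1 (a ord0)))))))))).
(* [T1] and [T2] bound the running times of the two machines, [G] and [O] the lengths of their
   outputs. *)
pose T1 n := p1.[size e * n]%R.
pose G n := size e * n + (T1 n + T1 n).
pose T2 n := p2.[G n + n]%R.
pose O n := G n + n + (T2 n + T2 n).
pose T n := ((ntapes M1).+1 * (8 * n + 2) + 2) + ((T1 n + 1) + ((4 * G n + 1)
  + ((4 * G n + 1) + (((ntapes M2).+1 * (8 * n + 2) + 2) + ((4 * n + 1)
  + ((T2 n + 1) + ((4 * O n + 1) + (4 * O n + 1)))))))).
apply: (@frag_polytime X inp out V F (a ord0)
  (map a (map (lift ord0) (enum 'I_k))) T).
- rewrite -[_ :: _]/(map a (ord0 :: map (lift ord0) (enum 'I_k))) -enum_ordSl.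
  by rewrite map_inj_uniq ?enum_uniq // => i j [].
- by move=> x; rewrite sz !size_map -enumT size_enum_ord.
- by rewrite /T /O /T2 /G /T1; poly_bound.
move=> x; set N := sumn _.
have [n1 [le_n1 h1 o1]] := H1 x.
have gsz : size (g x) <= G N.
  apply: leq_trans (computes_within_size (H1 x)) _.
  have le_s := sumn_select e (inp x).
  rewrite /G /T1 addnn leq_add // leq_double; exact: horner_nat_leq.
have le_T1 : n1 <= T1 N.
  by apply: leq_trans le_n1 _; apply: horner_nat_leq; apply: sumn_select.
have [n2 [le_n2 h2 o2]] := H2 x.
have le_s2 : sumn (map size (g x :: inp x)) <= G N + N by rewrite /= leq_add2r.
have le_T2 : n2 <= T2 N by apply: leq_trans le_n2 _; apply: horner_nat_leq.
have osz : size (out x) <= O N.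
  apply: leq_trans (computes_within_size (H2 x)) _.
  rewrite /O /T2 addnn leq_add // leq_double; exact: horner_nat_leq.
set c1 := iter _ _ _ in h1 o1; set c2 := iter _ _ _ in h2 o2.
pose s (i : 'I_k.+1) := nth [::] (inp x) i.
have s_le i : size (s i) <= N by apply: size_nth_sumn.
set t0 := fun v : V => _.
have t0E v : t0 v = if v is inl (inl i) then stack (s i) else stack [::].
  rewrite /t0 -[_ :: _]/(map a (ord0 :: map (lift ord0) (enum 'I_k))).
  rewrite -enum_ordSl; case: v => [[i|i]|v].
  - by rewrite -[inl _]/(a i) index_map ?index_enum_ord // => ? ? [].
  - congr stack; rewrite nth_default // sz memNindex ?size_map -?enumT ?size_enum_ord //.
    by apply/negP => /mapP [].
  - congr stack; rewrite nth_default // sz memNindex ?size_map -?enumT ?size_enum_ord //.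
    by apply/negP => /mapP [].
have [|||||||| t1 [ex1 t1E t1f]] :=
    @exec_copy_pairs V _ _ a f1 src1 tmp t0 s N; rewrite /tmp //.
  by move=> i j [].
have ex2 : exec (fcall f1 d1) t1 n1.+1
    (fun v => if d1 v is Some i then tape_stream (c1.2 i) else t1 v).
  apply: exec_call h1 => // -[[|j]|] //= _ [<-].
  rewrite -/(f1 j) t1f /src1 t0E /=; case: insubP => [i _ iE|].
    rewrite /s iE; congr stack; rewrite /select.
    case: (ltnP j (size e)) => je; first by rewrite (nth_map k.+1).
    by move: (ltn_ord i); rewrite iE nth_default // ltnn.
  rewrite -leqNgt => le_k; congr stack.
  case: (ltnP j (size e)) => je; last by rewrite nth_default ?size_map.
  by rewrite (nth_map k.+1) // nth_default // sz.
move: ex2; set t2 := fun v => _ => ex2.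
have [||t3 [ex3 t3E _]] :=
    @exec_move V (f1 ord0) (pred1 tmp) t2 (g x) (fun=> [::]).
- by rewrite -o1; apply: tape_stream_shows.
- by move=> v _ /eqP ->; rewrite /t2 /= t1E // t0E.
have t3t : t3 tmp = stack (rev (g x)) by rewrite t3E.
have [||t4 [ex4 t4E t4t]] :=
    @exec_move V tmp (pred1 (f2 ord0)) t3 (rev (g x)) (fun=> [::]).
- by rewrite t3t; apply: shows_stack.
- by move=> v _ /eqP ->; rewrite t3E //= /t2 /= t1E // t0E.
have t4a i : t4 (a i) = stack (s i).
  by rewrite t4E //= t3E //= /t2 /= t1E // t0E.
have t4f j : t4 (f2 j) = if j == ord0 then stack (g x) else stack [::].
  rewrite t4E //= -[catrev _ _]/(rev (rev (g x))) revK.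
  have -> : (f2 j == f2 ord0) = (j == ord0) by [].
  by case: (j == ord0); rewrite // t3E //= /t2 /= t1E // t0E.
have [|||||||| t5 [ex5 t5E t5f]] :=
    @exec_copy_pairs V _ _ a f2 src2 tmp t4 s N; rewrite /tmp //.
- by move=> i j [].
- by move=> j; rewrite t4f /src2; case: eqP => [->|].
- by rewrite t4t // t3t.
have t5a : t5 (a ord0) = stack (s ord0) by rewrite t5E.
have ex6 := exec_clear t5a; move: ex6; set t6 := fun v => _ => ex6.
have ex7 : exec (fcall f2 d2) t6 n2.+1
    (fun v => if d2 v is Some i then tape_stream (c2.2 i) else t6 v).
  apply: exec_call h2 => // -[|[j|]] //= _ [<-].
  rewrite /t6 /= -/(f2 j) t5f /src2 t4f; case: j => -[|j] lt_j //=.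
  case: insubP => [i _ iE|]; first by rewrite /s iE.
  by rewrite -leqNgt => le_k; rewrite nth_default // sz.
move: ex7; set t7 := fun v => _ => ex7.
have [||t8 [ex8 t8E _]] :=
    @exec_move V (f2 ord0) (pred1 tmp) t7 (out x) (fun=> [::]).
- by rewrite -o2; apply: tape_stream_shows.
- by move=> v _ /eqP ->; rewrite /t7 /= /t6 /= t5E // t4t // t3t.
have t8t : t8 tmp = stack (rev (out x)) by rewrite t8E.
have [||t9 [ex9 t9E _]] :=
    @exec_move V tmp (pred1 (a ord0)) t8 (rev (out x)) (fun=> [::]).
- by rewrite t8t; apply: shows_stack.
- by move=> v _ /eqP ->; rewrite t8E //= /t7 /= /t6 eqxx.
exists t9; last first.
  rewrite t9E //= -[catrev _ _]/(rev (rev (out x))) revK.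
  exact: shows_stack.
rewrite !size_rev in ex4 ex9; have sz0 := s_le ord0.
rewrite /F /T; apply: exec_seq; first exact: ex1.
apply: exec_seq; first by apply: exec_leq ex2; rewrite addn1.
apply: exec_seq; first by apply: exec_leq ex3; lia.
apply: exec_seq; first by apply: exec_leq ex4; lia.
apply: exec_seq; first exact: ex5.
apply: exec_seq; first by apply: exec_leq ex6; lia.
apply: exec_seq; first by apply: exec_leq ex7; rewrite addn1.
apply: exec_seq; first by apply: exec_leq ex8; lia.
by apply: exec_leq ex9; lia.
Qed.

(** * Elementary functions on strings *)

Lemma polytime_heads (X : Type) (inp : X -> seq bits) (k : nat)
    (phi : (nat -> option bool) -> bool) :
  (forall x, size (inp x) = k.+1) ->
  polytime inp (fun x => enc_bool (phi (fun i => ohead (nth [::] (inp x) i)))).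
Proof.
move=> sz.
pose set0 b : frag 'I_k.+1 :=
  fseq (fclear ord0) (fops (fun i => if i == ord0 then Push b else Keep)).
pose test (r : 'I_k.+1 -> option bool) :=
  phi (fun i => if insub i is Some j then r j else None).
apply: (@frag_polytime _ _ _ 'I_k.+1 (fif test (set0 true) (set0 false)) ord0
  [seq lift ord0 i | i : 'I_k <- enum 'I_k] (fun n => 4 * n + 4)).
- by rewrite -enum_ordSl enum_uniq.
- by move=> x; rewrite sz size_map size_enum_ord.
- by poly_bound.
move=> x; set t := fun v : 'I_k.+1 => stack _.
have tE i : t i = stack (nth [::] (inp x) i).
  by rewrite /t -enum_ordSl index_enum_ord.
have -> : phi (fun i => ohead (nth [::] (inp x) i)) = test (reads t).
  congr phi; apply: functional_extensionality => i.
  case: insubP => [j _ <-|]; first by rewrite /reads tE sread_stack.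
  by rewrite -leqNgt => le_k; rewrite nth_default ?sz.
pose t' : 'I_k.+1 -> stape :=
  fun v => if v == ord0 then stack [:: test (reads t)] else t v.
exists t'; last by rewrite /t' eqxx; apply: shows_stack.
rewrite addnS; apply: exec_if.
have -> : (if test (reads t) then set0 true else set0 false) =
  set0 (test (reads t)) by case: (test _).
apply: (@exec_leq _ _ _ _ (4 * size (nth [::] (inp x) 0) + 1 + 2)).
  by have := size_nth_sumn (inp x) 0; lia.
apply: exec_seq (exec_clear (tE ord0)) _.
rewrite (_ : t' = fun v => sop (if v == ord0 then Push (test (reads t))
  else Keep) (if v == ord0 then stack [::] else t v)); first exact: exec_ops.
apply: functional_extensionality => v; rewrite /t'.
by case: eqP => // _; rewrite sop_stack.
Qed.

Lemma polytime_behead (X : Type) (h : X -> bits) :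
  polytime (fun x => [:: h x]) (fun x => behead (h x)).
Proof.
apply: (@frag_polytime _ _ _ unit (fops (fun=> Pop)) tt [::] (fun=> 2)) => //.
  by poly_bound.
move=> x; exists (fun=> stack (behead (h x))); last exact: shows_stack.
exact: (@sexec_ops unit (fun=> Pop) (fun=> h x)).
Qed.

Definition dec_option (c : bits) : option bits :=
  if c is true :: y then Some y else None.

(** A certificate is an arbitrary string, whereas the machine for [beta] is only specified on
    encodings of answers; this normalisation bridges the two. *)
Lemma polytime_normalize_option (X : Type) (h : X -> bits) :
  polytime (fun x => [:: h x]) (fun x => enc_option (dec_option (h x))).
Proof.
pose F : frag unit := fif (fun r => r tt == Some true) (fskip unit)
  (fseq (fclear tt) (fops (fun=> Push false))).
apply: (@frag_polytime _ _ _ unit F tt [::] (fun n => 4 * n + 4)) => //.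
  by poly_bound.
move=> x; exists (fun=> stack (enc_option (dec_option (h x))));
  last exact: shows_stack.
rewrite addnS; apply: exec_if; rewrite /reads sread_stack /= addn0.
case: eqP => [|].
  case: (h x) => [|[] y] //= _.
  by apply: (@exec_leq _ _ _ _ 2); [lia | apply: exec_skip].
move=> hN; have -> : dec_option (h x) = None by case: (h x) hN => [|[]].
have ex1 := @exec_clear unit tt (fun=> stack (h x)) _ erefl.
apply: (@exec_leq _ _ _ _ (4 * size (h x) + 1 + 2)); first by lia.
apply: exec_seq ex1 _; exact: (@sexec_ops unit (fun=> Push false) (fun=> [::])).
Qed.

(** * Checking homomorphisms *)

(* The tapes hold the unread part of the instance, the unread and the already
   read part of the candidate solution, and a flag that is empty as long as no
   violation has been found. *)
Definition quad (T : Type) (e y z f : T) : bool * bool -> T :=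
  fun v => match v with
           | (false, false) => e
           | (false, true) => y
           | (true, false) => z
           | (true, true) => f
           end.

Notation tapeE := (false, false).
Notation tapeY := (false, true).
Notation tapeZ := (true, false).
Notation tapeF := (true, true).
Notation qfrag := (frag (prod bool bool)).

Definition qops (o1 o2 o3 o4 : op) : qfrag := fops (quad o1 o2 o3 o4).

Lemma sexec_qops o1 o2 o3 o4 e y z f :
  sexec (qops o1 o2 o3 o4) (quad e y z f) 2
        (quad (bop o1 e) (bop o2 y) (bop o3 z) (bop o4 f)).
Proof.
rewrite (_ : quad (bop o1 e) _ _ _ =
  fun v => bop (quad o1 o2 o3 o4 v) (quad e y z f v)); first exact: sexec_ops.
by apply: functional_extensionality => -[[] []].
Qed.

Definition qskip : qfrag := qops Keep Keep Keep Keep.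
Definition qfail : qfrag := qops Keep Keep Keep (Push true).
Definition qpop : qfrag := qops Pop Keep Keep Keep.
Definition qforth (b : bool) : qfrag := qops Keep Pop (Push b) Keep.
Definition qback (b : bool) : qfrag := qops Keep (Push b) Pop Keep.

Definition qrestore : qfrag :=
  fwhile (fun r => r tapeZ != None)
         (fif (fun r => r tapeZ == Some true) (qback true) (qback false)).

Lemma sexec_restore e y z f :
  sexec qrestore (quad e y z f) (4 * size z + 1) (quad e (catrev z y) [::] f).
Proof.
elim: z y => [|b z IH] y /=; first exact: sexec_while_done.
have -> : 4 * (size z).+1 + 1 = (3 + (4 * size z + 1)).+1 by lia.
apply: sexec_while_more (IH _) => //; apply: sexec_if.
by case: b => /=; apply: sexec_qops.
Qed.

(** * Unary numbers and lists of them *)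

Definition enc_nats (vs : seq nat) : bits := flatten (map unary vs).

Lemma enc_ordsE n (t : seq 'I_n) : enc_ords t = enc_nats (map val t).
Proof. by rewrite /enc_nats -map_comp. Qed.

Lemma enc_nats_cat us vs : enc_nats (us ++ vs) = enc_nats us ++ enc_nats vs.
Proof. by rewrite /enc_nats map_cat flatten_cat. Qed.

Lemma size_unary n : size (unary n) = n.+1.
Proof. by rewrite size_rcons size_nseq. Qed.

Lemma enc_nats_cat_inj us vs s s' : size us = size vs ->
  enc_nats us ++ s = enc_nats vs ++ s' -> us = vs /\ s = s'.
Proof.
elim: us vs => [|u us IH] [|v vs] //= [szE].
by rewrite /enc_nats /= -!catA => /unary_cat_inj [-> /(IH _ szE) [-> ->]].
Qed.

Definition qskip_nat : qfrag :=
  fseq (fwhile (fun r => r tapeY == Some true) (qforth true)) (qforth false).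

Lemma sexec_skip_nat v e y z f :
  sexec qskip_nat (quad e (unary v ++ y) z f) (3 * v + 3)
        (quad e y (catrev (unary v) z) f).
Proof.
have -> : 3 * v + 3 = (3 * v + 1) + 2 by lia.
apply: (@exec_seq _ _ _ _ (fun a => stack
  (quad e (false :: y) (catrev (nseq v true) z) f a))).
  elim: v z => [|v IH] z; first exact: sexec_while_done.
  have -> : 3 * v.+1 + 1 = (2 + (3 * v + 1)).+1 by lia.
  by apply: sexec_while_more (IH _) => //; apply: sexec_qops.
rewrite (_ : catrev (unary v) z = false :: catrev (nseq v true) z).
  exact: sexec_qops.
by rewrite /unary -cats1 catrev_catl.
Qed.

(** The unary number on the instance tape serves as loop counter: it is the index of the entry to be
    reached. *)
Definition qskip_nats : qfrag :=
  fwhile (fun r => r tapeE == Some true) (fseq qpop qskip_nat).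

Lemma sexec_skip_nats us e y z f :
  sexec qskip_nats (quad (unary (size us) ++ e) (enc_nats us ++ y) z f)
        (3 * size (enc_nats us) + 3 * size us + 1)
        (quad (false :: e) y (catrev (enc_nats us) z) f).
Proof.
elim: us z => [|u us IH] z; first exact: sexec_while_done.
rewrite /enc_nats /= -/(enc_nats us) size_cat size_unary catrev_catl -catA.
apply: (@exec_leq _ _ _ _ ((2 + (3 * u + 3)) +
  (3 * size (enc_nats us) + 3 * size us + 1)).+1); first by lia.
apply: sexec_while_more (IH _) => //.
by apply: exec_seq (sexec_skip_nat _ _ _ _ _); apply: sexec_qops.
Qed.

(* The number read, below [fuel], is kept in the control state: [k] selects the
   continuation. *)
Fixpoint qread (k : nat -> qfrag) (bad : qfrag) (fuel j : nat) : qfrag :=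
  if fuel is fuel'.+1 then
    fif (fun r => r tapeY == Some true)
        (fseq (qforth true) (qread k bad fuel' j.+1))
        (fif (fun r => r tapeY == Some false) (fseq (qforth false) (k j)) bad)
  else bad.

Lemma sexec_read k bad fuel j v e y z f n s' : v < fuel ->
  sexec (k (j + v)) (quad e y (catrev (unary v) z) f) n s' ->
  sexec (qread k bad fuel j) (quad e (unary v ++ y) z f) (3 * v + 4 + n) s'.
Proof.
elim: fuel j v z => [|fuel IH] j [|v] z //= lt_v ex.
  have -> : 3 * 0 + 4 + n = (2 + n).+2 by lia.
  do 2 apply: sexec_if => /=; apply: exec_seq; first exact: sexec_qops.
  by rewrite addn0 in ex.
have -> : 3 * v.+1 + 4 + n = (2 + (3 * v + 4 + n)).+1 by lia.
apply: sexec_if => /=; apply: exec_seq; first exact: sexec_qops.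
by apply: IH => //; rewrite addSnnS.
Qed.

Lemma sexec_read_bad k fuel j e y z f :
  (forall v y', v < fuel -> y <> unary v ++ y') ->
  exists y' z', sexec (qread k qfail fuel j) (quad e y z f) (3 * fuel + 4)
                      (quad e y' z' (true :: f)).
Proof.
elim: fuel j y z => [|fuel IH] j y z yP.
  by exists y, z; apply: exec_leq (sexec_qops _ _ _ _ _ _ _ _).
case: y yP => [|[] y] yP.
- exists [::], z; apply: (@exec_leq _ _ _ _ 4); first by lia.
  by do 2 apply: sexec_if => /=; apply: sexec_qops.
- have [|y' [z' ex]] := IH j.+1 y (true :: z).
    by move=> v y' lt_v yE; apply: (yP v.+1 y') => //; rewrite yE.
  exists y', z'; have -> : 3 * fuel.+1 + 4 = (2 + (3 * fuel + 4)).+1 by lia.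
  apply: sexec_if => /=; apply: exec_seq ex; exact: sexec_qops.
- by case: (yP 0 y).
Qed.

Definition qlookup (b : nat) (k : nat -> qfrag) : qfrag :=
  fseq qskip_nats (fseq qpop (qread (fun v => fseq qrestore (k v)) qskip b 0)).

(** A lookup takes time linear in [enc_nats vs] and in [i]: three steps per bit going forward and
    four per bit restoring, hence the 7. Charging this to the bits of [unary i] makes the costs of
    successive lookups add up to a multiple of the length of the instance read. *)
Lemma sexec_lookup b k vs i e f n s' : i < size vs -> all (gtn b) vs ->
  sexec (k (nth 0 vs i)) (quad e (enc_nats vs) [::] f) n s' ->
  sexec (qlookup b k) (quad (unary i ++ e) (enc_nats vs) [::] f)
        ((7 * size (enc_nats vs) + 8) * size (unary i) + n) s'.
Proof.
move=> lt_i vs_b ex; set v := nth 0 vs i in ex.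
have yE : enc_nats vs =
    enc_nats (take i vs) ++ unary v ++ enc_nats (drop i.+1 vs).
  by rewrite -{1}(cat_take_drop i vs) (drop_nth 0) // enc_nats_cat.
have szE : size (take i vs) = i by rewrite size_takel // ltnW.
rewrite size_unary; have /(congr1 size) := yE; rewrite !size_cat size_unary.
move=> sz; set Y := size (enc_nats vs) in sz *.
apply: (@exec_leq _ _ _ _ ((3 * size (enc_nats (take i vs)) + 3 * i + 1) +
  (2 + (3 * v + 4 + ((4 * Y + 1) + n))))); first by lia.
have ex1 := sexec_skip_nats (take i vs) e (unary v ++ enc_nats (drop i.+1 vs))
  [::] f.
rewrite szE -yE in ex1.
apply: exec_seq ex1 _; apply: exec_seq; first exact: sexec_qops.
apply: sexec_read; first exact: (allP vs_b _ (mem_nth 0 lt_i)).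
apply: exec_seq ex; rewrite /= -catrev_catl.
set z := catrev _ _; have zE : catrev z (enc_nats (drop i.+1 vs)) = enc_nats vs.
  by rewrite /z !catrevE cats0 revK yE catA.
rewrite -zE; apply: exec_leq (sexec_restore _ _ _ _).
by rewrite /z catrevE cats0 size_rev size_cat size_unary; lia.
Qed.

(** The program is a decision tree of depth [k] that branches over the values below [b]. The values
    found so far are recorded by the position in the tree, so [P acc] is decided when the program is
    built and not when it runs. *)
Fixpoint qcheck_tuple (b : nat) (P : pred (seq nat)) (k : nat) (acc : seq nat) :
    qfrag :=
  if k is k'.+1 then qlookup b (fun v => qcheck_tuple b P k' (rcons acc v))
  else if P acc then qskip else qfail.

Lemma sexec_check_tuple b P vs t acc e f :
  all (gtn (size vs)) t -> all (gtn b) vs ->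
  sexec (qcheck_tuple b P (size t) acc)
        (quad (enc_nats t ++ e) (enc_nats vs) [::] f)
        ((7 * size (enc_nats vs) + 8) * size (enc_nats t) + 2)
        (quad e (enc_nats vs) [::]
              (if P (acc ++ map (nth 0 vs) t) then f else true :: f)).
Proof.
move=> + vs_b; elim: t acc => [|i t IH] acc /=.
  by move=> _; rewrite cats0 muln0; case: (P acc); apply: sexec_qops.
case/andP=> lt_i t_lt; rewrite /enc_nats /= -!/(enc_nats _) size_cat mulnDr.
rewrite -catA -addnA; apply: sexec_lookup => //.
by rewrite -cat_rcons; apply: IH.
Qed.

Definition qcheck_rel (b : nat) (P : pred (seq nat)) (k : nat) : qfrag :=
  fseq (fwhile (fun r => r tapeE == Some true)
               (fseq qpop (qcheck_tuple b P k [::]))) qpop.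

Definition enc_nat_tuples (ts : seq (seq nat)) : bits :=
  rcons (flatten [seq true :: enc_nats t | t <- ts]) false.

(** A violation does not stop the loop but only marks the flag tape, so the instance is consumed in
    the same way in all cases. *)
Lemma sexec_check_rel b P k vs ts e f :
  all (fun t => (size t == k) && all (gtn (size vs)) t) ts ->
  all (gtn b) vs ->
  exists f', nilp f' = nilp f && all (fun t => P (map (nth 0 vs) t)) ts /\
  sexec (qcheck_rel b P k)
        (quad (enc_nat_tuples ts ++ e) (enc_nats vs) [::] f)
        ((7 * size (enc_nats vs) + 8) * size (enc_nat_tuples ts))
        (quad e (enc_nats vs) [::] f').
Proof.
move=> ts_ok vs_b; set D := 7 * _ + 8.
suff [f' [f'E ex]] : exists f',
    nilp f' = nilp f && all (fun t => P (map (nth 0 vs) t)) ts /\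
    sexec (fwhile (fun r => r tapeE == Some true)
                  (fseq qpop (qcheck_tuple b P k [::])))
      (quad (enc_nat_tuples ts ++ e) (enc_nats vs) [::] f)
      (D * size (flatten [seq true :: enc_nats t | t <- ts]) + 1)
      (quad (false :: e) (enc_nats vs) [::] f').
  exists f'; split=> //; rewrite size_rcons mulnS.
  apply: exec_leq (exec_seq ex (sexec_qops _ _ _ _ _ _ _ _)); lia.
elim: ts f ts_ok => [|t ts IH] f /=.
  by move=> _; exists f; rewrite andbT muln0; split=> //; apply: sexec_while_done.
case/andP=> /andP [/eqP szt t_lt] /IH {}IH.
pose f1 := if P (map (nth 0 vs) t) then f else true :: f.
have [f' [f'E ex]] := IH f1; exists f'; split.
  by rewrite f'E /f1; case: (P _); rewrite ?andbF ?andbT.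
apply: (@exec_leq _ _ _ _ ((2 + (D * size (enc_nats t) + 2)) +
  (D * size (flatten [seq true :: enc_nats t | t <- ts]) + 1)).+1).
  by rewrite /= size_cat; lia.
apply: sexec_while_more ex => //; apply: exec_seq; first exact: sexec_qops.
rewrite -szt /enc_nat_tuples /= rcons_cat -catA; exact: sexec_check_tuple.
Qed.

Lemma sexec_check_rels b (S : Type) (P : S -> pred (seq nat)) (k : S -> nat)
    (ts : S -> seq (seq nat)) ss vs f :
  (forall s, all (fun t => (size t == k s) && all (gtn (size vs)) t) (ts s)) ->
  all (gtn b) vs ->
  exists f',
    nilp f' =
      nilp f && all (fun s => all (fun t => P s (map (nth 0 vs) t)) (ts s)) ss /\
  sexec (foldr (fun s => fseq (qcheck_rel b (P s) (k s))) qskip ss)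
        (quad (flatten [seq enc_nat_tuples (ts s) | s <- ss])
              (enc_nats vs) [::] f)
        ((7 * size (enc_nats vs) + 8) *
           size (flatten [seq enc_nat_tuples (ts s) | s <- ss]) + 2)
        (quad [::] (enc_nats vs) [::] f').
Proof.
move=> ts_ok vs_b; elim: ss f => [|s ss IH] f /=.
  by exists f; rewrite andbT muln0; split=> //; apply: sexec_qops.
have [f1 [f1E ex1]] := sexec_check_rel (P s)
  (flatten [seq enc_nat_tuples (ts s) | s <- ss]) f (ts_ok s) vs_b.
have [f' [f'E ex2]] := IH f1; exists f'; split; first by rewrite f'E f1E andbA.
by rewrite size_cat mulnDr -addnA; apply: exec_seq ex1 ex2.
Qed.

(** * Parsing and verifying a candidate solution *)

Definition qparse (b : nat) : qfrag :=
  fwhile (fun r => (r tapeE == Some true) && (r tapeF == None))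
         (fseq qpop (qread (fun=> qskip) qfail b 0)).

(** The negative case has to exclude every decomposition of [y], because rejection by the verifier
    must be correct. The bound on [e'] pays for erasing that tape at the end. *)
Lemma sexec_parse b n e y z :
  exists e' y' z' f', [/\
    sexec (qparse b) (quad (unary n ++ e) y z [::]) ((3 * b + 10) * n + 1)
          (quad e' y' z' f'),
    size e' <= size (unary n ++ e)
  & if nilp f' then
      e' = false :: e /\
      exists vs, [/\ size vs = n, all (gtn b) vs, y = enc_nats vs ++ y'
                   & z' = catrev (enc_nats vs) z]
    else forall vs y'', size vs = n -> all (gtn b) vs -> y <> enc_nats vs ++ y''].
Proof.
elim: n y z => [|n IH] y z.
  exists (false :: e), y, z, [::]; rewrite muln0; split=> //=.
    exact: sexec_while_done.
  by split=> //; exists [::].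
have [[v lt_v [y1 yE]]|yN] :
    (exists2 v, v < b & exists y1, y = unary v ++ y1) \/
    (forall v y', v < b -> y <> unary v ++ y').
  have [/hasP [v]|/hasPn H] :=
      boolP (has (fun v => prefix (unary v) y) (iota 0 b)).
    rewrite mem_iota add0n => /andP [_ lt_v] /prefixP [y1 yE].
    by left; exists v => //; exists y1.
  right=> v y' lt_v yE; have := H v; rewrite mem_iota lt_v => /(_ isT).
  by rewrite yE prefix_prefix.
- have [e' [y' [z' [f' [ex sz fP]]]]] := IH y1 (catrev (unary v) z).
  exists e', y', z', f'; split.
  + apply: (@exec_leq _ _ _ _
      ((2 + (3 * v + 4 + 2)) + ((3 * b + 10) * n + 1)).+1); first by lia.
    apply: sexec_while_more ex => //; apply: exec_seq; first exact: sexec_qops.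
    by rewrite yE; apply: sexec_read => //; apply: sexec_qops.
  + by apply: leq_trans sz _; rewrite /= leqnSn.
  + case: ifP fP => _ => [[-> [vs [szv vs_b y1E ->]]]|fP].
      split=> //; exists (v :: vs).
      by rewrite /= szv vs_b lt_v yE y1E /enc_nats /= catrev_catl -catA.
    move=> [|u us] y'' //= [szu] /andP [lt_u us_b].
    rewrite yE /enc_nats /= -catA => /unary_cat_inj [_].
    exact: fP.
- have [y' [z' ex]] := @sexec_read_bad (fun=> qskip) b 0 (unary n ++ e) y z [::] yN.
  exists (unary n ++ e), y', z', [:: true]; split.
  + apply: (@exec_leq _ _ _ _ ((2 + (3 * b + 4)) + 1).+1); first by lia.
    apply: sexec_while_more (sexec_while_done _ _) => //=; last by rewrite andbF.
    apply: exec_seq ex; exact: sexec_qops.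
  + by rewrite /= leqnSn.
  + move=> [|v vs] y'' //= _ /andP [lt_v _].
    by rewrite /enc_nats /= -catA; apply: yN.
Qed.

Definition qanswer (a : bool) : qfrag :=
  fseq (fclear tapeE) (qops (Push a) Keep Keep Keep).

Lemma sexec_answer a e y z f :
  sexec (qanswer a) (quad e y z f) (4 * size e + 3) (quad [:: a] y z f).
Proof.
have -> : 4 * size e + 3 = 4 * size e + 1 + 2 by lia.
apply: exec_seq (sexec_qops (Push a) Keep Keep Keep [::] y z f).
have := @exec_clear (bool * bool)%type tapeE
  (fun v => stack (quad e y z f v)) e erefl.
congr exec; apply: functional_extensionality => -[[] []] //.
Qed.

Definition qverify (b : nat) (body : qfrag) : qfrag :=
  fseq (qparse b)
  (* The candidate must be used up after [n] numbers, since a solution is exactly the encoding of a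
     list and not a string that extends it. *)
  (fseq (fif (fun r => (r tapeF == None) && (r tapeY == None))
             (fseq qpop (fseq qrestore body)) qfail)
        (fif (fun r => r tapeF == None) (qanswer true) (qanswer false))).

Lemma sexec_verify b (S : Type) (P : S -> pred (seq nat)) (k : S -> nat)
    (ts : S -> seq (seq nat)) ss n y :
  (forall s, all (fun t => (size t == k s) && all (gtn n) t) (ts s)) ->
  let rest := flatten [seq enc_nat_tuples (ts s) | s <- ss] in
  let N := size (unary n ++ rest) + size y in
  exists (a : bool) s', [/\
    sexec (qverify b (foldr (fun s => fseq (qcheck_rel b (P s) (k s))) qskip ss))
          (quad (unary n ++ rest) y [::] [::])
          ((3 * b + 10) * N + 1 + (6 + 4 * N + (7 * N + 8) * N + (4 * N + 4))) s',
    s' tapeE = [:: a]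
  & a <-> exists vs, [/\ size vs = n, all (gtn b) vs, y = enc_nats vs
    & all (fun s => all (fun t => P s (map (nth 0 vs) t)) (ts s)) ss]].
Proof.
move=> ts_ok rest N; set body := foldr _ _ _.
have [e' [y' [z' [f' [ex1 sz fP]]]]] := sexec_parse b n rest y [::].
have nN : n <= N by rewrite /N size_cat size_unary; lia.
have yN : size y <= N by rewrite /N leq_addl.
have eN : size (unary n ++ rest) <= N by rewrite leq_addr.
have rN : size rest <= N by rewrite /N size_cat; lia.
have le1 : (3 * b + 10) * n + 1 <= (3 * b + 10) * N + 1.
  by rewrite leq_add2r leq_mul2l nN orbT.
have {}ex1 := exec_leq le1 ex1.
have finish e1 y1 z1 f1 a : a = nilp f1 -> size e1 <= N ->
    sexec (fif (fun r => r tapeF == None) (qanswer true) (qanswer false))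
          (quad e1 y1 z1 f1) (4 * N + 4) (quad [:: a] y1 z1 f1).
  move=> -> sz1; apply: (@exec_leq _ _ _ _ (4 * size e1 + 3).+1); first by lia.
  by apply: sexec_if; case: f1 => [|? ?] /=; apply: sexec_answer.
have [/andP [f'0 y'0]|bad] := boolP (nilp f' && nilp y').
- rewrite f'0 in fP; case: fP => e'E [vs [szv vs_b yE z'E]].
  have {f'0} f'E : f' = [::] by apply/nilP.
  have {y'0} y'E : y' = [::] by apply/nilP.
  rewrite y'E cats0 in yE; subst e' f' y' z'.
  have ts_ok' s : all (fun t => (size t == k s) && all (gtn (size vs)) t) (ts s).
    by rewrite szv; apply: ts_ok.
  have [f1 [f1E ex3]] := @sexec_check_rels b S P k ts ss vs [::] ts_ok' vs_b.
  rewrite -/rest -/body -yE in ex3.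
  exists (nilp f1), (quad [:: nilp f1] y [::] f1); split=> //.
  + apply: exec_seq ex1 _; apply: exec_seq (finish [::] y [::] f1 _ erefl (leq0n N)).
    apply: (@exec_leq _ _ _ _ (2 + (4 * size y + 1 + ((7 * size y + 8) * size rest
      + 2))).+1).
      have : (7 * size y + 8) * size rest <= (7 * N + 8) * N.
        by apply: leq_mul => //; lia.
      by lia.
    apply: sexec_if => /=; apply: exec_seq; first exact: sexec_qops.
    apply: exec_seq ex3 => /=.
    have := sexec_restore rest [::] (catrev (enc_nats vs) [::]) [::].
    by rewrite !catrevE !cats0 revK size_rev -yE.
  + rewrite f1E /=; split=> [ok|[us [szu us_b usE ok]]]; first by exists vs.
    (* Decoding is unique, so the list in the specification is the one that was parsed. *)
    have [||-> //] := @enc_nats_cat_inj vs us [::] [::]; rewrite ?szv //.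
    by rewrite !cats0 -yE -usE.
- exists false, (quad [:: false] y' z' (true :: f')); split=> //.
  + apply: exec_seq ex1 _.
    apply: exec_seq (finish _ _ _ (true :: f') false erefl (leq_trans sz eN)).
    apply: (@exec_leq _ _ _ _ 3); first by lia.
    apply: sexec_if => /=.
    have -> : (ohead f' == None) && (ohead y' == None) = false.
      by apply/negbTE; apply: contra bad; case: (f') (y') => [|? ?] [].
    exact: sexec_qops.
  + split=> // -[us [szu us_b usE _]].
    case: ifP fP bad => [f'0 [_ [vs [szv _ yE _]]]|_ fP _].
      have [||_ <-] := @enc_nats_cat_inj us vs [::] y'; rewrite ?szu ?f'0 //.
      by rewrite cats0 -usE.
    by case: (fP us [::] szu us_b); rewrite cats0.
Qed.

(** * Homomorphisms as lists of ranks *)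

Definition hom_check (sigma : signature) (B : structure sigma)
    (I : input sigma) (y : bits) : bool :=
  [exists h : {ffun 'I_(isize I) -> dom B},
    [forall s, forall t : (arity s).-tuple 'I_(isize I),
      (t \in irel I s) ==> (map_tuple h t \in rel B s)] &&
    (y == @enc_hom sigma I B h)].

Lemma hom_checkP (sigma : signature) (T : template sigma) (I : input sigma) y :
  reflect (sPCSP_solution T I y) (hom_check (tB T) I y).
Proof.
apply: (iffP existsP) => [[h /andP [/forallP hh /eqP ->]]|[h hh ->]].
  by exists h => // s t tI; have /forallP /(_ t) /implyP /(_ tI) := hh s.
exists [ffun i => h i]; apply/andP; split; last first.
  apply/eqP; congr enc_ords; apply: eq_map => i; by rewrite ffunE.
apply/forallP => s; apply/forallP => t; apply/implyP => /hh.
suff -> : map_tuple [ffun i => h i] t = map_tuple h t by [].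
by apply: val_inj; apply: eq_map => i; rewrite /= ffunE.
Qed.

Definition rank_tuple (sigma : signature) (B : structure sigma)
    (s : symbol sigma) : pred (seq nat) :=
  fun u => [exists t in rel B s, u == [seq val (enum_rank x) | x <- val t]].

(** The right-hand side mentions only lists of numbers and has the shape decided by [qverify]. *)
Lemma hom_check_ranks (sigma : signature) (B : structure sigma)
    (I : input sigma) y :
  hom_check B I y <-> exists vs, [/\ size vs = isize I, all (gtn #|dom B|) vs,
    y = enc_nats vs
  & all (fun s => all (fun u => rank_tuple B s (map (nth 0 vs) u))
                      [seq map val (val t) | t <- enum (irel I s)])
        (enum (symbol sigma))].
Proof.
split=> [/existsP [h /andP [/forallP hh /eqP ->]]|[vs [szv vs_b -> ok]]].
  exists [seq val (enum_rank (h i)) | i <- enum 'I_(isize I)]; split.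
  - by rewrite size_map size_enum_ord.
  - by apply/allP => _ /mapP [i _ ->] /=; apply: ltn_ord.
  - by rewrite /enc_hom enc_ordsE -map_comp.
  apply/allP => s _; apply/allP => _ /mapP [t tI ->].
  have /forallP /(_ t) := hh s; rewrite mem_enum in tI; rewrite tI /= => ht.
  apply/existsP; exists (map_tuple h t); rewrite ht /=.
  apply/eqP; rewrite -!map_comp; apply: eq_map => i /=.
  by rewrite (nth_map i) -?enumT ?size_enum_ord // nth_ord_enum.
have lt_v (i : 'I_(isize I)) : nth 0 vs i < #|dom B|.
  by apply: (allP vs_b); rewrite mem_nth // szv.
pose h : {ffun 'I_(isize I) -> dom B} := [ffun i => enum_val (Ordinal (lt_v i))].
have hE i : val (enum_rank (h i)) = nth 0 vs i by rewrite ffunE enum_valK.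
apply/existsP; exists h; apply/andP; split; last first.
  apply/eqP; rewrite /enc_hom enc_ordsE; congr enc_nats; rewrite -map_comp.
  apply: (@eq_from_nth _ 0); first by rewrite size_map size_enum_ord.
  rewrite szv => i lt_i; rewrite (nth_map (Ordinal lt_i)) ?size_enum_ord //=.
  by rewrite -[enum_rank _ : nat]/(val _) hE nth_enum_ord.
apply/forallP => s; apply/forallP => t; apply/implyP => tI.
have /allP /(_ s) := ok; rewrite mem_enum => /(_ isT) /allP.
move=> /(_ (map val (val t))).
have -> : map val (val t) \in [seq map val (val t) | t <- enum (irel I s)].
  by apply: (map_f (fun t => map val (val t))); rewrite mem_enum.
case/(_ isT)/existsP=> u /andP [uB /eqP uE].
suff -> : map_tuple h t = u by [].
apply: val_inj; apply: (inj_map (@enum_rank_inj (dom B))).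
apply: (inj_map val_inj); rewrite -[RHS]map_comp -uE -!map_comp.
by apply: eq_map => i /=; apply: hE.
Qed.

Lemma enc_tuplesE n k (ts : seq (k.-tuple 'I_n)) :
  enc_tuples ts = enc_nat_tuples [seq map val (val t) | t <- ts].
Proof.
rewrite /enc_tuples /enc_nat_tuples -map_comp; congr (rcons (flatten _) _).
by apply: eq_map => t /=; rewrite enc_ordsE.
Qed.

Lemma polytime_hom_check (sigma : signature) (B : structure sigma) :
  polytime (fun xy : input sigma * bits => [:: enc_input xy.1; xy.2])
           (fun xy => enc_bool (hom_check B xy.1 xy.2)).
Proof.
set b := #|dom B|.
apply: (@frag_polytime _ _ _ (bool * bool)%type
  (qverify b (foldr (fun s => fseq (qcheck_rel b (rank_tuple B s) (arity s)))
                    qskip (enum (symbol sigma))))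
  tapeE [:: tapeY] (fun N =>
    (3 * b + 10) * N + 1 + (6 + 4 * N + (7 * N + 8) * N + (4 * N + 4)))) => //.
  by poly_bound.
case=> I y /=; rewrite addn0.
have IE : enc_input I = unary (isize I) ++ flatten [seq enc_nat_tuples
    [seq map val (val t) | t <- enum (irel I s)] | s <- enum (symbol sigma)].
  congr (_ ++ flatten _); apply: eq_map => s; exact: enc_tuplesE.
have [|a [s' [ex s'E aP]]] := @sexec_verify b _ (rank_tuple B) (@arity sigma)
  (fun s => [seq map val (val t) | t <- enum (irel I s)])
  (enum (symbol sigma)) (isize I) y.
  move=> s; apply/allP => _ /mapP [t _ ->]; rewrite size_map size_tuple eqxx.
  by apply/allP => _ /mapP [i _ ->] /=.
exists (fun v => stack (s' v)).
  rewrite IE; move: ex; congr exec; apply: functional_extensionality.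
  by move=> [[] []].
have <- : a = hom_check B I y by apply/idP/idP => [/aP|] /hom_check_ranks // /aP.
by rewrite s'E; apply: shows_stack.
Qed.

Lemma size_enc_ords n (t : seq 'I_n) : size (enc_ords t) <= size t * n.
Proof.
elim: t => [|i t IH] //=; rewrite /enc_ords /= size_cat size_unary mulSn.
by rewrite leq_add.
Qed.

Lemma inFNP_sPCSP (sigma : signature) (T : template sigma) : inFNP (sPCSP T).
Proof.
(* There is one rank per element of the instance, each below the size of B and hence of at most that
   many bits in unary. *)
exists (hom_check (tB T)), ('X * (#|dom (tB T)|)%:P)%R; split.
  exact: polytime_hom_check.
move=> I y; split=> [sol|[_ /hom_checkP] //]; split; last exact/hom_checkP.
case: sol => h _ ->; rewrite hornerM_nat hornerX hornerC.
apply: leq_trans (size_enc_ords _) _; rewrite size_map size_enum_ord.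
by rewrite leq_mul2r /enc_input size_cat size_unary orbC leqW ?leq_addr.
Qed.

(** * From hardness to NP = coNP *)

Lemma inNP_ext (L L' : language) : (forall x, L x <-> L' x) ->
  inNP L -> inNP L'.
Proof.
move=> LL' [V [p [pV LV]]]; exists V, p; split=> // x.
by rewrite -LL'; apply: LV.
Qed.

(** The promise is solvability itself, so rejection is a valid answer exactly on the strings outside
    the language. *)
Definition np_search (V : bits -> bits -> bool) (p : {poly nat}) :
    search_problem :=
  @SearchProblem bits id (fun _ _ => id)
    (fun x => exists y, size y <= p.[size x]%R /\ V x y)
    (fun x y => size y <= p.[size x]%R /\ V x y) (fun _ => id).

Lemma inFNP_np_search V p :
  polytime (fun xy : bits * bits => [:: xy.1; xy.2])
           (fun xy => enc_bool (V xy.1 xy.2)) -> inFNP (np_search V p).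
Proof. by move=> pV; exists V, p. Qed.

Definition answer_check (sigma : signature) (B : structure sigma)
    (f : input sigma -> bool) (I : input sigma) (z : option bits) : bool :=
  if z is Some y then hom_check B I y else ~~ f I.

(** A homomorphism to B is valid in any case. If [f] says no, then there is no homomorphism to A and
    the promise fails, so rejection is valid even when a homomorphism to B exists. *)
Lemma answer_check_valid (sigma : signature) (T : template sigma) f
    (I : input sigma) z :
  (hom_to I (tA T) -> f I = true) -> answer_check (tB T) f I z ->
  @valid (sPCSP T) I z.
Proof.
move=> fA; case: z => [y|] /=.
  by move/hom_checkP=> sol; split=> [_|/(_ y)//]; exists y.
by move=> /negP fI; split=> // /fA.
Qed.

Lemma answer_check_exists (sigma : signature) (T : template sigma) f
    (I : input sigma) :
  (~ hom_to I (tB T) -> f I = false) ->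
  exists z, answer_check (tB T) f I z.
Proof.
move=> fB; have [[h hh]|/fB fI] := classic (hom_to I (tB T)).
  by exists (Some (enc_hom h)); apply/hom_checkP; exists h.
by exists None; rewrite /= fI.
Qed.

Lemma hard_NP_coNP (sigma : signature) (T : template sigma) :
  PCSP_polytime T -> FNP_hard (sPCSP T) ->
  forall L, inNP L -> inNP (fun x => ~ L x).
Proof.
move=> [f [pf fP]] hard L [V [p [pV LV]]].
have [alpha [beta [pa pb red]]] := hard _ (inFNP_np_search p pV).
have validN x z : @valid (np_search V p) x z -> (z = None <-> ~ L x).
  case=> v1 v2; split=> [zN /LV /v1 [y]|NL]; first by rewrite zN.
  by apply: v2 => y sol; apply: NL; apply/LV; exists y.
pose cert x c := answer_check (tB T) f (alpha x) (dec_option c) &&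
                 (beta x (dec_option c) == None).
have [q Hq] := polytime_size pa.
pose b := #|dom (tB T)|.
(* One tag bit, and at most [b] bits for each element of [alpha x], whose encoding has length
   bounded by [q]. *)
exists cert, (q * b%:P + 1%:P)%R; split; last first.
  move=> x; split=> [NL|[c [_ /andP [ok /eqP bN]]]]; last first.
    apply/(validN x (beta x (dec_option c))) => //; apply: red.
    by apply: answer_check_valid ok; case: (fP (alpha x)).
  have [z ok] := answer_check_exists (proj2 (fP (alpha x))).
  exists (enc_option z); split; last first.
    have decK : dec_option (enc_option z) = z by case: (z).
    rewrite /cert decK ok /=; apply/eqP/(validN x) => //; apply: red.
    by apply: answer_check_valid ok; case: (fP (alpha x)).
  rewrite hornerD_nat hornerM_nat !hornerC addn1.
  case: z ok => [y /hom_checkP [h _ ->]|] //=; rewrite ltnS.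
  apply: leq_trans (size_enc_ords _) _; rewrite size_map size_enum_ord.
  rewrite leq_mul2r; apply/orP; right; have := Hq x; rewrite /= addn0.
  by apply: leq_trans; rewrite /enc_input size_cat size_unary leqW ?leq_addr.
(* The checker is a straight-line program. Each binding puts its value in front and shifts the
   earlier ones by one, which accounts for the index lists. *)
apply: (@polytime_let _ _ (fun xc : bits * bits => enc_option (dec_option xc.2)) _ 1
  [:: 1]) => //=.
  exact: (polytime_normalize_option (fun xc => xc.2)).
apply: (@polytime_let _ _ (fun xc : bits * bits => enc_input (alpha xc.1)) _ 2
  [:: 1]) => //=.
  exact: (polytime_pull (fun xc : bits * bits => xc.1) pa).
apply: (@polytime_let _ _ (fun xc : bits * bits => enc_bool (f (alpha xc.1))) _ 3
  [:: 0]) => //=.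
  exact: (polytime_pull (fun xc : bits * bits => alpha xc.1) pf).
(* The PCSP algorithm and the homomorphism test are both run whatever the answer is; its tag decides
   at the end which result counts. *)
apply: (@polytime_let _ _ (fun xc : bits * bits =>
  behead (enc_option (dec_option xc.2))) _ 4 [:: 2]) => //=.
  exact: (polytime_behead (fun xc => enc_option (dec_option xc.2))).
apply: (@polytime_let _ _ (fun xc : bits * bits =>
  enc_bool (hom_check (tB T) (alpha xc.1)
    (behead (enc_option (dec_option xc.2))))) _ 5 [:: 2; 0]) => //=.
  exact: (polytime_pull (fun xc : bits * bits =>
    (alpha xc.1, behead (enc_option (dec_option xc.2))))
    (polytime_hom_check (tB T))).
apply: (@polytime_let _ _ (fun xc : bits * bits =>
  enc_option (beta xc.1 (dec_option xc.2))) _ 6 [:: 5; 4]) => //=.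
  exact: (polytime_pull (fun xc : bits * bits => (xc.1, dec_option xc.2)) pb).
(* The positions are 0 for the tag of the answer of [beta], 1 for the homomorphism test, 3 for [f]
   and 5 for the tag of the guessed answer. *)
pose phi (r : nat -> option bool) :=
  (if r 5 == Some true then r 1 == Some true else r 3 == Some false) &&
  (r 0 == Some false).
have := @polytime_heads _ (fun xc : bits * bits =>
  [:: enc_option (beta xc.1 (dec_option xc.2));
      enc_bool (hom_check (tB T) (alpha xc.1)
        (behead (enc_option (dec_option xc.2))));
      behead (enc_option (dec_option xc.2)); enc_bool (f (alpha xc.1));
      enc_input (alpha xc.1); enc_option (dec_option xc.2); xc.1; xc.2]) 7 phi.
move=> /(_ (fun=> erefl)); congr polytime.
apply: functional_extensionality => -[x c] /=; congr enc_bool.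
rewrite /phi /cert /answer_check /=; congr andb; last by case: (beta _ _).
by case: (dec_option c) => [y|] /=; case: (_ (alpha x)) => //=; case: hom_check.
Qed.

Theorem theorem9p1 (sigma : signature) (T : template sigma)
    (polyPCSP : PCSP_polytime T) (NPcoNP : NP_neq_coNP) :
  ~ FNP_hard (sPCSP T) /\
  (~ polytime_solvable (sPCSP T) -> FNP_intermediate (sPCSP T)).
Proof.
suff nhard : ~ FNP_hard (sPCSP T).
  by split=> // nsolv; split=> //; apply: inFNP_sPCSP.
move=> hard; apply: NPcoNP => L; split; first exact: hard_NP_coNP polyPCSP hard L.
(* The converse is the same implication for the complement of [L], up to a double negation. *)
move/(hard_NP_coNP polyPCSP hard); apply: inNP_ext => x.
by split=> [/NNPP|Lx /(_ Lx)].
Qed.
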